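(* Let $p$ be a prime number, let $\mathcal{X}^{-}$ and $\mathcal{X}^{+}$ be the nonsymmetric operads over the field $\mathbb{F}_p$ generated by four binary operations $x,y,z,t$ subject to the sixteen quadratic relations listed in the context (with the sign $-$, respectively $+$, in relation (16)), and let $\mathcal{X}^{\pm}_n$ denote their components of arity $n\ge 1$. (a) If $p\neq 2$, then $$\dim_{\mathbb{F}_p}\mathcal{X}^-_n=\binom{2n}{n-1}\quad\text{for all } n\ge 1,\ n\neq 3,$$ $$\dim_{\mathbb{F}_p}\mathcal{X}^+_n=\binom{2n}{n-1}+1\quad\text{for all } n\ge 5.$$ (b) If $p=2$, then $$\dim_{\mathbb{F}_p}\mathcal{X}^-_n=\dim_{\mathbb{F}_p}\mathcal{X}^+_n=\binom{2n}{n-1}+1\quad\text{for all } n\ge 5.$$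
   Context: Let $k$ be a field (in the claim, $k=\mathbb{F}_p$). The free nonsymmetric operad $\mathcal{T}$ over $k$ on four binary operations $x,y,z,t$ has as its arity $n$ component $\mathcal{T}_n$ ($n\ge 1$) the $k$-vector space with basis all planar rooted binary trees with $n$ leaves whose $n-1$ internal vertices are labelled by elements of $\{x,y,z,t\}$. Equivalently, the basis consists of all fully parenthesized monomials in the operations $x,y,z,t$ in which the arguments $a_1,\dots,a_n$ occur exactly once each, in this order; for $n=1$ the only basis element is the identity operation. Operadic composition is grafting of trees. There is no action of symmetric groups. For a choice of sign $\pm$, the operad $\mathcal{X}^{\pm}$ over $k$ is the quotient of $\mathcal{T}$ by the operadic ideal generated by the following sixteen relations of arity three (each relation ''$L=R$'' means that $L-R$ is a generator of the ideal): (1) $x(x(a_1,a_2),a_3)=x(a_1,x(a_2,a_3))+x(a_1,t(a_2,a_3))$, (2) $x(x(a_1,a_2),a_3)=x(a_1,y(a_2,a_3))+x(a_1,z(a_2,a_3))$, (3) $x(z(a_1,a_2),a_3)=z(a_1,x(a_2,a_3))+z(a_1,t(a_2,a_3))$, (4) $z(x(a_1,a_2),a_3)=z(a_1,z(a_2,a_3))+z(a_1,y(a_2,a_3))$, (5) $z(z(a_1,a_2),a_3)=z(a_1,z(a_2,a_3))+z(a_1,y(a_2,a_3))$, (6) $x(t(a_1,a_2),a_3)=t(a_1,x(a_2,a_3))$, (7) $x(t(a_1,a_2),a_3)=t(a_1,z(a_2,a_3))$, (8) $x(y(a_1,a_2),a_3)=y(a_1,x(a_2,a_3))$, (9) $z(t(a_1,a_2),a_3)=y(a_1,z(a_2,a_3))$,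 (10) $z(y(a_1,a_2),a_3)=y(a_1,z(a_2,a_3))$, (11) $t(x(a_1,a_2),a_3)+t(t(a_1,a_2),a_3)=t(a_1,t(a_2,a_3))$, (12) $t(x(a_1,a_2),a_3)+t(t(a_1,a_2),a_3)=t(a_1,y(a_2,a_3))$, (13) $t(z(a_1,a_2),a_3)+t(y(a_1,a_2),a_3)=y(a_1,t(a_2,a_3))$, (14) $y(x(a_1,a_2),a_3)+y(t(a_1,a_2),a_3)=y(a_1,y(a_2,a_3))$, (15) $y(z(a_1,a_2),a_3)+y(y(a_1,a_2),a_3)=y(a_1,y(a_2,a_3))$, (16) $y(z(a_1,a_2),a_3)-y(x(a_1,a_2),a_3)=\pm\bigl(x(a_1,t(a_2,a_3))-x(a_1,y(a_2,a_3))\bigr)$. The operad $\mathcal{X}^+$ is obtained with the sign $+$ in (16), and $\mathcal{X}^-$ with the sign $-$ in (16). The arity $n$ component of the quotient is denoted $\mathcal{X}^{\pm}_n$. *)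

(* Defs.v *)
From HB Require Import structures.
From mathcomp Require Import all_boot all_order all_algebra.
From mathcomp Require Import boolp.

Set Implicit Arguments.
Unset Strict Implicit.
Unset Printing Implicit Defensive.

Import GRing.Theory.
Local Open Scope ring_scope.

Inductive binop := OpX | OpY | OpZ | OpT.

Definition binop_code (o : binop) : 'I_4 :=
  match o with
  | OpX => inord 0 | OpY => inord 1 | OpZ => inord 2 | OpT => inord 3
  end.
Definition binop_decode (i : 'I_4) : binop := nth OpX [:: OpX; OpY; OpZ; OpT] i.
Lemma binop_codeK : cancel binop_code binop_decode.
Proof. by case; rewrite /binop_decode /= inordK. Qed.
HB.instance Definition _ := Finite.copy binop (can_type binop_codeK).

Inductive tree := Leaf | Node of binop & tree & tree.

Fixpoint tree_code (t : tree) : GenTree.tree binop :=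
  match t with
  | Leaf => GenTree.Node 0 [::]
  | Node o l r => GenTree.Node 1 [:: GenTree.Leaf o; tree_code l; tree_code r]
  end.
Fixpoint tree_decode (c : GenTree.tree binop) : option tree :=
  match c with
  | GenTree.Node 0 [::] => Some Leaf
  | GenTree.Node 1 [:: GenTree.Leaf o; l; r] =>
      match tree_decode l, tree_decode r with
      | Some l', Some r' => Some (Node o l' r')
      | _, _ => None
      end
  | _ => None
  end.
Lemma tree_codeK : pcancel tree_code tree_decode.
Proof. by elim=> //= o l -> r ->. Qed.
HB.instance Definition _ := Countable.copy tree (pcan_type tree_codeK).

Fixpoint leaves (t : tree) : nat :=
  match t with Leaf => 1 | Node _ l r => (leaves l + leaves r)%N end.

Lemma leaves_gt0 t : (0 < leaves t)%N.
Proof. by elim: t => //= o l IHl r _; rewrite addn_gt0 IHl. Qed.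

(* Leaves are numbered from 0, left to right; for i < leaves s, graft s i t   *)
(* replaces the i-th leaf of s by t, i.e. it is the monomial s o_(i+1) t.     *)
Fixpoint graft (s : tree) (i : nat) (t : tree) : tree :=
  match s with
  | Leaf => t
  | Node o l r =>
      if (i < leaves l)%N then Node o (graft l i t) r
      else Node o l (graft r (i - leaves l) t)
  end.

Lemma leaves_graft s i t :
  (i < leaves s)%N -> leaves (graft s i t) = (leaves s + leaves t).-1.
Proof.
elim: s i => [|o l IHl r IHr] i //= lt_i; case: ltnP => [lt_il|le_li] /=.
  by rewrite IHl // addnAC -!subn1 addnBAC // addn_gt0 leaves_gt0.
rewrite IHr; last by rewrite ltn_subLR.
by rewrite -addnA -!subn1 addnBA // addn_gt0 leaves_gt0.
Qed.

Record ntree (n : nat) := NTree { ntval :> tree; _ : leaves ntval == n }.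
HB.instance Definition _ n := [isSub for @ntval n].
HB.instance Definition _ n := [Countable of ntree n by <:].

Fixpoint trees_upto (h : nat) : seq tree :=
  if h is h'.+1 then
    Leaf :: [seq Node o lr.1 lr.2 | o <- enum {: binop},
               lr <- [seq (l, r) | l <- trees_upto h', r <- trees_upto h']]
  else [::].
Lemma mem_trees_upto h t : (leaves t <= h)%N -> t \in trees_upto h.
Proof.
elim: h t => [|h IHh] [|o l r] //=; first by rewrite leqNgt addn_gt0 leaves_gt0.
move=> le_lr; rewrite inE /=; apply/allpairsP.
exists (o, (l, r)); split; rewrite ?mem_enum //=.
apply/allpairsP; exists (l, r); split => //=; apply: IHh; rewrite -ltnS.
  by apply: leq_trans le_lr; rewrite -addn1 leq_add2l leaves_gt0.
by apply: leq_trans le_lr; rewrite -add1n leq_add2r leaves_gt0.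
Qed.
Definition ntree_enum n : seq (ntree n) := undup (pmap insub (trees_upto n)).
Lemma mem_ntree_enum n : ntree_enum n =i {: ntree n}.
Proof.
move=> t; rewrite mem_undup mem_pmap_sub /= mem_trees_upto //.
by case: t => t /= /eqP ->.
Qed.
HB.instance Definition _ n := isFinite.Build (ntree n)
  (Finite.uniq_enumP (undup_uniq _) (@mem_ntree_enum n)).

Definition freeop (k : fieldType) (n : nat) := {ffun ntree n -> k^o}.
HB.instance Definition _ k n := Vector.on (freeop k n).

Definition monomial (k : fieldType) n (t : ntree n) : freeop k n :=
  [ffun u => (u == t)%:R].

(* The bilinear extension of grafting: the coefficient of u collects the      *)
(* products f s * g t over all pairs with graft s i t = u. It is the partial  *)
(* composition f o_(i+1) g, of arity m + n - 1, and is only meaningful for    *)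
(* i < m.                                                                     *)
Definition opcomp (k : fieldType) m n (f : freeop k m) (i : nat)
    (g : freeop k n) : freeop k (m + n).-1 :=
  [ffun u : ntree (m + n).-1 =>
     \sum_(s : ntree m) \sum_(t : ntree n | graft s i t == u) f s * g t].

Lemma opcomp_monomial k m n (s : ntree m) i (t : ntree n)
    (u : ntree (m + n).-1) :
  graft s i t = u -> opcomp (monomial k s) i (monomial k t) = monomial k u.
Proof.
move=> def_u; apply/ffunP=> v; rewrite !ffunE (bigD1 s) //= [X in _ + X]big1.
  rewrite addr0 ffunE eqxx; under eq_bigr do rewrite ffunE mul1r.
  case: (eqVneq v u) => [->|ne_vu].
    rewrite (bigD1 t) ?def_u //= eqxx big1 ?addr0 // => t' /andP[_ /negPf->] //.
  rewrite big1 // => t' /eqP def_v; case: eqP => // def_t; case/eqP: ne_vu.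
  by apply: val_inj; rewrite -[val v]def_v -[val u]def_u def_t.
by move=> s' /negPf ne_s; rewrite big1 // => t' _; rewrite ffunE ne_s mul0r.
Qed.

Section GeneratedIdeal.

Variables (k : fieldType) (a : nat) (G : seq (freeop k a)).

Record operadic_ideal (J : forall n, {vspace freeop k n}) : Prop := {
  ideal_compl : forall m n (f : freeop k m) i (g : freeop k n),
    (i < m)%N -> f \in J m -> opcomp f i g \in J (m + n).-1;
  ideal_compr : forall m n (f : freeop k m) i (g : freeop k n),
    (i < m)%N -> g \in J n -> opcomp f i g \in J (m + n).-1
}.

Definition in_generated_ideal n (v : freeop k n) : Prop :=
  forall J, operadic_ideal J -> {subset G <= J a} -> v \in J n.

End GeneratedIdeal.

Lemma vspace_of_submod (k : fieldType) (V : vectType k) (P : V -> Prop) :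
    P 0 -> (forall c u v, P u -> P v -> P (c *: u + v)) ->
  exists U : {vspace V}, forall v, v \in U <-> P v.
Proof.
move=> P0 PL.
pose Q d := `[< exists2 U : {vspace V}, \dim U = d & forall v, v \in U -> P v >].
have exQ : exists d, Q d.
  exists 0%N; apply/asboolP; exists 0%VS; rewrite ?dimv0 // => v.
  by rewrite memv0 => /eqP->.
have ubQ d : Q d -> (d <= \dim {:V})%N.
  by move=> /asboolP[U <- _]; rewrite dimvS ?subvf.
case: (ex_maxnP exQ ubQ) => d /asboolP[U dimU UP] maxd.
exists U => v; split=> [/UP //|Pv].
have UvP w : w \in (U + <[v]>)%VS -> P w.
  by case/memv_addP=> u /UP Pu [_ /vlineP[c ->] ->]; rewrite addrC; apply: PL.
have /maxd : Q (\dim (U + <[v]>)) by apply/asboolP; exists (U + <[v]>)%VS.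
rewrite -dimU => le_dim.
have /eqP-> : U == (U + <[v]>)%VS by rewrite eqEdim addvSl.
by rewrite (subvP (addvSr U _)) ?memv_line.
Qed.

Section GeneratedIdealSpace.

Variables (k : fieldType) (a : nat) (G : seq (freeop k a)).

Lemma generated_ideal_ex n :
  exists U : {vspace freeop k n}, forall v, v \in U <-> in_generated_ideal G v.
Proof.
apply: vspace_of_submod => [J _ _|c u v Pu Pv J idJ GJ]; first exact: mem0v.
by rewrite memvD ?memvZ ?Pu ?Pv.
Qed.

Definition generated_ideal n : {vspace freeop k n} :=
  projT1 (cid (generated_ideal_ex n)).

Lemma generated_idealP n (v : freeop k n) :
  v \in generated_ideal n <-> in_generated_ideal G v.
Proof. exact: (projT2 (cid (generated_ideal_ex n))). Qed.

Lemma operadic_ideal_generated : operadic_ideal generated_ideal.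
Proof.
split=> m n f i g lt_im /generated_idealP gen; apply/generated_idealP.
  by move=> J idJ GJ; apply: ideal_compl => //; apply: gen.
by move=> J idJ GJ; apply: ideal_compr => //; apply: gen.
Qed.

Lemma mem_generated_ideal : {subset G <= generated_ideal a}.
Proof. by move=> v Gv; apply/generated_idealP => J _; apply. Qed.

Lemma generated_ideal_min J :
  operadic_ideal J -> {subset G <= J a} ->
  forall n, (generated_ideal n <= J n)%VS.
Proof. by move=> idJ GJ n; apply/subvP=> v /generated_idealP; apply. Qed.

End GeneratedIdealSpace.

Section VspaceQuotient.

Variables (k : fieldType) (V : vectType k) (U : {vspace V}).

Definition vquot := Quotient.quot (pred_of_vspace U).
HB.instance Definition _ := GRing.Zmodule.on vquot.

Definition vquot_pi (v : V) : vquot := \pi_(vquot)%qT v.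

Lemma vquot_piD : {morph vquot_pi : u v / u + v}.
Proof. by move=> u v; rewrite /vquot_pi raddfD. Qed.

Lemma vquot_pi_eq u v : (vquot_pi u == vquot_pi v) = (u - v \in U).
Proof. by rewrite /vquot_pi -Quotient.idealrBE. Qed.

Lemma vquot_reprK q : vquot_pi (repr q) = q.
Proof. exact: reprK. Qed.

Definition vquot_scale (c : k) (q : vquot) : vquot := vquot_pi (c *: repr q).

Lemma vquot_piZ c v : vquot_scale c (vquot_pi v) = vquot_pi (c *: v).
Proof.
apply/eqP; rewrite vquot_pi_eq -scalerBr memvZ //.
by rewrite -vquot_pi_eq vquot_reprK.
Qed.

Fact vquot_scaleA c d q : vquot_scale c (vquot_scale d q) = vquot_scale (c * d) q.
Proof. by rewrite -[q]vquot_reprK !vquot_piZ scalerA. Qed.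
Fact vquot_scale1 : left_id 1 vquot_scale.
Proof. by move=> q; rewrite -[q]vquot_reprK vquot_piZ scale1r. Qed.
Fact vquot_scaleDr : right_distributive vquot_scale +%R.
Proof.
move=> c q r; rewrite -[q]vquot_reprK -[r]vquot_reprK -vquot_piD !vquot_piZ.
by rewrite scalerDr vquot_piD.
Qed.
Fact vquot_scaleDl q : {morph vquot_scale^~ q : c d / c + d}.
Proof.
by move=> c d; rewrite -[q]vquot_reprK !vquot_piZ scalerDl vquot_piD.
Qed.
HB.instance Definition _ := GRing.Zmodule_isLmodule.Build k vquot
  vquot_scaleA vquot_scale1 vquot_scaleDr vquot_scaleDl.

Fact vquot_pi_is_linear : linear vquot_pi.
Proof. by move=> c u v; rewrite vquot_piD -vquot_piZ. Qed.
HB.instance Definition _ := GRing.isLinear.Build k V vquot _ vquot_pi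
  vquot_pi_is_linear.

Let projC (v : V) : V := v - projv U v.

Let projC_pi v : projC (repr (vquot_pi v)) = projC v.
Proof.
have rU : repr (vquot_pi v) - v \in U by rewrite -vquot_pi_eq vquot_reprK.
rewrite -[repr _](subrK v) /projC linearD /= (projv_id rU).
by rewrite opprD addrACA subrr add0r.
Qed.

Fact vquot_vect_iso : Vector.axiom (\dim (U^C)%VS) vquot.
Proof.
case: (subvs_vect_iso (U^C)%VS) => f f_lin f_bij.
exists (fun q => f (vsproj _ (projC (repr q)))) => [c q r|].
  rewrite -f_lin -linearP; congr (f (vsproj _ _)).
  rewrite -[q]vquot_reprK -[r]vquot_reprK -linearP !projC_pi.
  by rewrite /projC linearP scalerBr addrACA opprD.
case: f_bij => g fK gK; exists (fun x => vquot_pi (vsval (g x))) => [q|x].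
  rewrite fK vsprojK ?memv_projC // -[RHS]vquot_reprK; apply/eqP.
  by rewrite vquot_pi_eq /projC addrAC subrr sub0r memvN memv_proj.
rewrite projC_pi -[RHS]gK; congr f; apply: val_inj; rewrite /= vsprojK ?memv_projC //.
have /eqP : projv U (vsval (g x)) == 0 by rewrite -memv_ker lker_proj subvsP.
by rewrite /projC => ->; rewrite subr0.
Qed.
HB.instance Definition _ := Lmodule_hasFinDim.Build k vquot vquot_vect_iso.

Lemma dim_vquot : \dim {: vquot} = (\dim {: V} - \dim U)%N.
Proof. by rewrite dimvf -dimv_compl. Qed.

End VspaceQuotient.

Section OperadX.

Variable k : fieldType.

(* The basis elements o(o'(a1, a2), a3) and o(a1, o'(a2, a3)) of arity 3.     *)
Definition lmon (o o' : binop) : freeop k 3 :=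
  monomial k (@NTree 3 (Node o (Node o' Leaf Leaf) Leaf) isT).
Definition rmon (o o' : binop) : freeop k 3 :=
  monomial k (@NTree 3 (Node o Leaf (Node o' Leaf Leaf)) isT).

Local Notation x := OpX.
Local Notation y := OpY.
Local Notation z := OpZ.
Local Notation t := OpT.

(* Each pair (L, R) stands for the relation L = R; eps is the sign of the     *)
(* last one.                                                                  *)
Definition X_relations (eps : k) : seq (freeop k 3 * freeop k 3) :=
  [:: (lmon x x, rmon x x + rmon x t);
      (lmon x x, rmon x y + rmon x z);
      (lmon x z, rmon z x + rmon z t);
      (lmon z x, rmon z z + rmon z y);
      (lmon z z, rmon z z + rmon z y);
      (lmon x t, rmon t x);
      (lmon x t, rmon t z);
      (lmon x y, rmon y x);
      (lmon z t, rmon y z);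
      (lmon z y, rmon y z);
      (lmon t x + lmon t t, rmon t t);
      (lmon t x + lmon t t, rmon t y);
      (lmon t z + lmon t y, rmon y t);
      (lmon y x + lmon y t, rmon y y);
      (lmon y z + lmon y y, rmon y y);
      (lmon y z - lmon y x, eps *: (rmon x t - rmon x y))].

Definition X_ideal (eps : k) (n : nat) : {vspace freeop k n} :=
  generated_ideal [seq r.1 - r.2 | r <- X_relations eps] n.

Definition X_operad (eps : k) (n : nat) := vquot (X_ideal eps n).
HB.instance Definition _ eps n := Vector.on (X_operad eps n).

End OperadX.

Definition Xplus (k : fieldType) (n : nat) := X_operad (1 : k) n.
HB.instance Definition _ k n := Vector.on (Xplus k n).

Definition Xminus (k : fieldType) (n : nat) := X_operad (- 1 : k) n.
HB.instance Definition _ k n := Vector.on (Xminus k n).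

(* Main.v *)
(* Let Dend be the free dendriform operad, with basis the planar binary trees *)
(* with [n] nodes in arity [n], and let Dias be the operad of dialgebras, of  *)
(* dimension [n] in arity [n]. The assignment                                 *)
(*   x = prec (x) -|,  t = succ (x) -|,  z = prec (x) |-,  y = succ (x) |-    *)
(* maps both operads X onto Dend (x) Dias, whose arity [n] component has a    *)
(* basis of planar binary trees with one marked node, so has dimension        *)
(* [n * Catalan n = 'C(2 n, n - 1)]. The kernel is generated by the single    *)
(* ternary operation [kap a b c = y (x a b - z a b) c]. For the sign -, and   *)
(* if 2 is invertible, every composite of [kap] with a generator vanishes.    *)
(* For the sign +, the ideal of [kap] is a line in each arity >= 5: it is at  *)
(* most a line because most composites coincide or vanish, and it is not 0    *)
(* because X+ also maps to the associative operad, by [x = y] = product and   *)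
(* [z = t = 0], and this map does not vanish on [kap].                        *)

From HB Require Import structures.
Require Import Defs.
From mathcomp Require Import all_boot all_order all_algebra.
From mathcomp Require Import boolp zify.

Set Implicit Arguments.
Unset Strict Implicit.
Unset Printing Implicit Defensive.

Import GRing.Theory.

(** * Binary trees and Catalan numbers *)

(** The proof squeezes the ideal of relations between two explicit spaces. Sending a monomial to its
    marked dendriform image gives a linear map [dcoord_map] in each arity, onto a space of dimension
    ['C(2 * n, n.-1)] ([dcoord_map_full], [size_bts]). The relations lie in its kernel, because they
    hold in the truncated model [Marked] for either sign ([dcoord_X_ideal]). Conversely, the kernel
    lies in the relations plus the span of the composites of [kap] ([dcoord_kap_ideal]): where [kap]
    vanishes, elements that differ only by their marks are interchangeable as soon as the mark is
    forgotten, and a monomial is then determined by its marked image ([ev_dend]). The dimension is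
    thus the binomial coefficient plus the number of independent composites of [kap] modulo the
    relations.

    That number depends on the sign. By [kapE], [kap] can be written with the difference in its left
    or in its right factor, so that outer operations are absorbed, and inner ones move between the
    three slots at the price of the sign ([kap_mul_r]). For the sign -, this yields a linear system
    whose only solution is 0 once 2 is invertible ([kap_mul_minus]). For the sign +, operations move
    freely, a composite becomes a word applied to one [kap], and from two letters on every word is 0
    or equal to the word in [x] alone ([kap_plus]); that one is detected by [scalar_op]. If p = 2
    the two signs coincide.

    Ideals are handled through algebras: operations of arity n in a nonsymmetric operad are the
    elements of degree n of the free algebra on one generator ([ext_evQ_eq0]), so membership in an
    ideal becomes an identity between products. *)

Inductive bt := Bnil | Bnode of bt & bt.

Fixpoint tree_of_bt (T : bt) : tree :=
  if T is Bnode l r then Node OpX (tree_of_bt l) (tree_of_bt r) else Leaf.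
Fixpoint bt_of_tree (t : tree) : bt :=
  if t is Node _ l r then Bnode (bt_of_tree l) (bt_of_tree r) else Bnil.
Lemma tree_of_btK : cancel tree_of_bt bt_of_tree.
Proof. by elim=> //= l -> r ->. Qed.
HB.instance Definition _ := Countable.copy bt (can_type tree_of_btK).

Fixpoint nodes (T : bt) : nat :=
  if T is Bnode l r then (nodes l + nodes r).+1 else 0.

Lemma nodes_eq0 T : (nodes T == 0) = (T == Bnil).
Proof. by case: T. Qed.

(** Sequences of [k] trees with [n] nodes in all. An empty first tree is dropped; any other is
    replaced by its two subtrees, which lengthens the forest but costs a node. The recursion is
    therefore lexicographic, whence the nested fixpoint. *)
Fixpoint forests (n : nat) : nat -> seq (seq bt) :=
  fix forests_n (k : nat) : seq (seq bt) :=
    if k is k'.+1 then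
      [seq Bnil :: f | f <- forests_n k'] ++
      (if n is n'.+1 then
         [seq Bnode (nth Bnil f 0) (nth Bnil f 1) :: drop 2 f
            | f <- forests n' k'.+2]
       else [::])
    else if n is 0 then [:: [::]] else [::].

Arguments forests : simpl never.

Lemma forestsS n k :
  forests n k.+1 =
    [seq Bnil :: f | f <- forests n k] ++
    (if n is n'.+1 then
       [seq Bnode (nth Bnil f 0) (nth Bnil f 1) :: drop 2 f
          | f <- forests n' k.+2]
     else [::]).
Proof. by case: n. Qed.

Lemma forests0 n : forests n 0 = if n is 0 then [:: [::]] else [::].
Proof. by case: n. Qed.

Lemma mem_forests n k f :
  (f \in forests n k) = (size f == k) && (sumn (map nodes f) == n).
Proof.
elim: n k f => [|n IHn]; elim=> [|k IHk] f; rewrite ?forests0 1?forestsS.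
- by case: f.
- rewrite cats0; apply/mapP/andP => [[g]|].
    by rewrite IHk => /andP[/eqP <- /eqP g0] ->; rewrite /= g0.
  case: f => [[]//|[|l r] f] [//= /eqP[sf] f0]; exists f => //.
  by rewrite IHk sf eqxx.
- by case: f.
- rewrite mem_cat; apply/orP/andP => [[]/mapP[g]|].
  + by rewrite IHk => /andP[/eqP <- /eqP g0] ->; rewrite /= g0.
  + rewrite IHn; case: g => [|l [|r g]] //= /andP[/eqP[<-] /eqP <-] ->.
    by rewrite drop0 /= eqxx addSn addnA.
  case: f => [[]//|[|l r] f] [/= /eqP[sf] f0]; [left|right].
    by apply/mapP; exists f => //; rewrite IHk sf eqxx.
  apply/mapP; exists (l :: r :: f); last by rewrite /= drop0.
  by rewrite IHn /= sf eqxx /= addnA -eqSS -addSn.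
Qed.

Lemma uniq_forests n k : uniq (forests n k).
Proof.
elim: n k => [|n IHn]; elim=> [|k IHk]; rewrite ?forests0 1?forestsS //.
  by rewrite cats0 map_inj_uniq ?IHk // => f g [].
rewrite cat_uniq map_inj_uniq ?IHk; last by move=> f g [].
rewrite map_inj_in_uniq ?IHn.
  by rewrite andbT; apply/hasPn => f /mapP[g _ ->]; apply/mapP => -[].
move=> f g; rewrite !mem_forests => /andP[/eqP sf _] /andP[/eqP sg _].
case: f sf => [|l [|r f]] //= _; case: g sg => [|l' [|r' g]] //= _.
by rewrite !drop0 => -[-> -> ->].
Qed.

(* The ballot numbers, by the recursion on the first tree of a forest. *)
Lemma size_forests n k : (2 * n + k) * size (forests n k) = k * 'C(2 * n + k, n).
Proof.
elim: n k => [|n IHn]; elim=> [|k IHk]; rewrite ?forests0 1?forestsS ?muln0 //.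
  rewrite bin0 cats0 size_map; move: IHk; rewrite bin0; case: k => //= k; nia.
rewrite size_cat !size_map.
have := IHn k.+2; move: IHk; rewrite [in 2 * n + _]addnC.
have -> : 2 * n.+1 + k.+1 = (2 * n + k).+3 by lia.
have -> : 2 * n.+1 + k = (2 * n + k).+2 by lia.
have -> : k.+2 + 2 * n = (2 * n + k).+2 by lia.
set m := 2 * n + k => H1 H2.
have H3 := mul_bin_left m.+2 n; have H4 := binS m.+2 n.
rewrite H4.
have H5 : m.+2 - n = n + k.+2 by rewrite /m; lia.
rewrite H5 in H3.
(* Both induction hypotheses determine the sizes only after multiplication by [m.+2], so the goal is
   multiplied by it too. *)
apply/eqP; rewrite -(eqn_pmul2l (ltn0Sn m.+1)); apply/eqP.
move: (size _) (size _) ('C(_, _)) ('C(_, n)) H1 H2 H3 => B A b a H1 H2 H3.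
have {H1 H2}-> : m.+2 * (m.+3 * (A + B)) = m.+3 * (k * b + k.+2 * a).
  by rewrite -H1 -H2; lia.
rewrite /m; lia.
Qed.

Definition bts n : seq bt := map (nth Bnil ^~ 0) (forests n 1).

Lemma mem_bts n T : (T \in bts n) = (nodes T == n).
Proof.
apply/mapP/eqP => [[f]|def_n].
  rewrite mem_forests; case: f => [|a [|b f]] //= /eqP <- ->.
  by rewrite addn0.
by exists [:: T] => //; rewrite mem_forests /= addn0 def_n eqxx.
Qed.

Lemma uniq_bts n : uniq (bts n).
Proof.
rewrite map_inj_in_uniq ?uniq_forests // => f g.
rewrite !mem_forests => /andP[/eqP sf _] /andP[/eqP sg _].
by case: f sf => [|a [|b f]] //= _; case: g sg => [|c [|d g]] //= _ ->.
Qed.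

(** The case [k = 1] of [size_forests] says that 2n + 1 times the Catalan number is a binomial
    coefficient; [mul_bin_diag] turns it into this form. *)
Lemma size_bts n : 0 < n -> n * size (bts n) = 'C(2 * n, n.-1).
Proof.
case: n => // n _; rewrite size_map; apply/eqP.
rewrite -(eqn_pmul2l (ltn0Sn (2 * n.+1))) mul_bin_diag.
by have := size_forests n.+1 1; rewrite mul1n addn1 => <-; rewrite mulnCA.
Qed.

Local Open Scope ring_scope.

(** * Bilinear products on truncated free modules *)

Definition bilinear2 (k : fieldType) (A : lmodType k) (m : A -> A -> A) : Prop :=
  (forall c a a' b, m (c *: a + a') b = c *: m a b + m a' b) /\
  (forall c a b b', m a (c *: b + b') = c *: m a b + m a b').

Section Bilinear.

Variables (k : fieldType) (A : lmodType k) (m : A -> A -> A).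
Hypothesis bm : bilinear2 m.

Lemma bilDl a a' b : m (a + a') b = m a b + m a' b.
Proof. by have := bm.1 1 a a' b; rewrite !scale1r. Qed.
Lemma bilDr a b b' : m a (b + b') = m a b + m a b'.
Proof. by have := bm.2 1 a b b'; rewrite !scale1r. Qed.
Lemma bil0l b : m 0 b = 0.
Proof. by apply: (addrI (m 0 b)); rewrite -bilDl !addr0. Qed.
Lemma bil0r a : m a 0 = 0.
Proof. by apply: (addrI (m a 0)); rewrite -bilDr !addr0. Qed.
Lemma bilZl c a b : m (c *: a) b = c *: m a b.
Proof. by rewrite -[c *: a]addr0 bm.1 bil0l addr0. Qed.
Lemma bilZr c a b : m a (c *: b) = c *: m a b.
Proof. by rewrite -[c *: b]addr0 bm.2 bil0r addr0. Qed.
Lemma bilNl a b : m (- a) b = - m a b.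
Proof. by rewrite -scaleN1r bilZl scaleN1r. Qed.
Lemma bilNr a b : m a (- b) = - m a b.
Proof. by rewrite -scaleN1r bilZr scaleN1r. Qed.
Lemma bilBl a a' b : m (a - a') b = m a b - m a' b.
Proof. by rewrite bilDl bilNl. Qed.
Lemma bilBr a b b' : m a (b - b') = m a b - m a b'.
Proof. by rewrite bilDr bilNr. Qed.
Lemma bil_suml I (r : seq I) P F b :
  m (\sum_(i <- r | P i) F i) b = \sum_(i <- r | P i) m (F i) b.
Proof. by elim/big_rec2: _ => [|i u v _ <-]; rewrite ?bil0l ?bilDl. Qed.
Lemma bil_sumr I (r : seq I) P F a :
  m a (\sum_(i <- r | P i) F i) = \sum_(i <- r | P i) m a (F i).
Proof. by elim/big_rec2: _ => [|i u v _ <-]; rewrite ?bil0r ?bilDr. Qed.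

End Bilinear.

(* The space with basis the terms of an enumeration [s]; a term outside [s]   *)
(* stands for 0, so that a product on terms is truncated to [s].              *)
Section Truncated.

Variables (k : fieldType) (T : countType) (s : seq T).

Definition trunc := {ffun seq_sub s -> k^o}.
HB.instance Definition _ := Vector.on trunc.

Definition tr_basis (t : T) : trunc := [ffun i => (ssval i == t)%:R].

Lemma tr_basis0 t : t \notin s -> tr_basis t = 0.
Proof.
move=> /negP nst; apply/ffunP=> i; rewrite !ffunE.
by case: eqP => // def_t; case: nst; rewrite -def_t ssvalP.
Qed.

Lemma tr_expand (f : trunc) : f = \sum_i f i *: tr_basis (ssval i).
Proof.
apply/ffunP=> i; rewrite sum_ffunE (bigD1 i) //= !ffunE eqxx [_ *: _]mulr1.
rewrite big1 ?addr0 // => j ne_ji; rewrite !ffunE.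
case: eqP => [eq_ij|_]; last by rewrite scaler0.
by case/eqP: ne_ji; apply: val_inj.
Qed.

Lemma tr_ind (V : lmodType k) (F G : trunc -> V) :
    linear F -> linear G ->
    (forall t, t \in s -> F (tr_basis t) = G (tr_basis t)) ->
  F =1 G.
Proof.
move=> linF linG FG f; rewrite [f]tr_expand.
have lin_sum (H : trunc -> V) : linear H -> 
    H (\sum_i f i *: tr_basis (ssval i)) = \sum_i f i *: H (tr_basis (ssval i)).
  move=> linH; have H0 : H 0 = 0.
    have := linH 1 0 0; rewrite !scale1r !addr0 => H0D.
    by apply: (addrI (H 0)); rewrite -H0D addr0.
  by elim/big_rec2: _ => [|i u v _ <-]; rewrite ?linH.
by rewrite !lin_sum //; apply: eq_bigr => i _; rewrite FG ?ssvalP.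
Qed.

Variable b : T -> T -> seq T.

Definition tr_mul (f g : trunc) : trunc :=
  \sum_i \sum_j (f i * g j) *: \sum_(u <- b (ssval i) (ssval j)) tr_basis u.

Lemma tr_mul_bilinear : bilinear2 tr_mul.
Proof.
split=> c f f' g; rewrite /tr_mul scaler_sumr -big_split /=; apply: eq_bigr => i _;
  rewrite scaler_sumr -big_split /=; apply: eq_bigr => j _;
  rewrite scalerA -scalerDl !ffunE; congr (_ *: _).
  by rewrite mulrDl -mulrA.
by rewrite mulrDr mulrCA.
Qed.

Lemma tr_mul_basis t t' : t \in s -> t' \in s ->
  tr_mul (tr_basis t) (tr_basis t') = \sum_(u <- b t t') tr_basis u.
Proof.
move=> st st'; rewrite /tr_mul (bigD1 (SeqSub st)) //= [X in _ + X]big1.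
  rewrite addr0 (bigD1 (SeqSub st')) //= [X in _ + X]big1.
    by rewrite addr0 !ffunE !eqxx mulr1 scale1r.
  move=> j ne_j; rewrite !ffunE [ssval j == _](_ : _ = false) ?mulr0 ?scale0r //.
  by apply/eqP => def_t; case/eqP: ne_j; apply: val_inj.
move=> i ne_i; rewrite big1 // => j _; rewrite !ffunE.
rewrite [ssval i == _](_ : _ = false) ?mul0r ?scale0r //.
by apply/eqP => def_t; case/eqP: ne_i; apply: val_inj.
Qed.

End Truncated.

(** * Evaluation of trees in algebras *)

Section Extension.

Variables (k : fieldType) (V : lmodType k).

Definition ext (phi : tree -> V) n (f : freeop k n) : V :=
  \sum_(t : ntree n) f t *: phi t.

Lemma ext_is_linear phi n : linear (@ext phi n).
Proof.
move=> c f g; rewrite /ext scaler_sumr -big_split; apply: eq_bigr => t _ /=.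
by rewrite !ffunE scalerDl scalerA.
Qed.
HB.instance Definition _ phi n :=
  GRing.isLinear.Build k (freeop k n) V _ (@ext phi n) (@ext_is_linear phi n).

Lemma extD phi n (f g : freeop k n) : ext phi (f + g) = ext phi f + ext phi g.
Proof. exact: linearD. Qed.
Lemma extB phi n (f g : freeop k n) : ext phi (f - g) = ext phi f - ext phi g.
Proof. exact: linearB. Qed.
Lemma extZ phi n c (f : freeop k n) : ext phi (c *: f) = c *: ext phi f.
Proof. exact: linearZ. Qed.

Lemma ext_monomial phi n (t : ntree n) : ext phi (monomial k t) = phi t.
Proof.
rewrite /ext (bigD1 t) //= ffunE eqxx scale1r big1 ?addr0 // => u /negPf ne_u.
by rewrite ffunE ne_u scale0r.
Qed.

Lemma ext_opcomp phi m n (f : freeop k m) i (g : freeop k n) : (i < m)%N ->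
  ext phi (opcomp f i g) =
    \sum_(s : ntree m) \sum_(t : ntree n) (f s * g t) *: phi (graft s i t).
Proof.
move=> lt_im; rewrite /ext.
under eq_bigr => u _ do rewrite ffunE scaler_suml.
rewrite exchange_big; apply: eq_bigr => s _.
under eq_bigr => u _ do rewrite scaler_suml.
rewrite (exchange_big_dep xpredT) //=; apply: eq_bigr => t _.
have gP : leaves (graft s i t) == (m + n).-1.
  rewrite leaves_graft; last by rewrite (eqP (valP s)).
  by rewrite (eqP (valP s)) (eqP (valP t)).
by rewrite (big_pred1 (NTree gP)).
Qed.

End Extension.

Section Evaluation.

Variables (k : fieldType) (A : lmodType k) (mul : binop -> A -> A -> A).

(** The arguments form one infinite sequence and [i] is the number of the leftmost leaf, so that
    subtrees share [a] and no tuple has to be split. *)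
Fixpoint eval (t : tree) (a : nat -> A) (i : nat) : A :=
  match t with
  | Leaf => a i
  | Node o l r => mul o (eval l a i) (eval r a (i + leaves l))
  end.

Lemma eval_local t a b i :
  (forall j, (i <= j < i + leaves t)%N -> a j = b j) -> eval t a i = eval t b i.
Proof.
elim: t i => [|o l IHl r IHr] i ab /=.
  by apply: ab; rewrite leqnn addn1 leqnn.
congr mul; [apply: IHl|apply: IHr] => j lt_j; apply: ab => /=; lia.
Qed.

Lemma eval_shift t a i j : eval t a (i + j) = eval t (fun h => a (i + h)%N) j.
Proof. by elim: t j => //= o l IHl r IHr j; rewrite IHl -addnA IHr. Qed.

(** Grafting is substitution: earlier leaves of [s] keep their arguments, leaf [i] receives the
    value of [t], and later leaves skip the arguments that [t] consumes. *)
Lemma eval_graft s i t a h : (i < leaves s)%N ->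
  eval (graft s i t) a h =
    eval s (fun j => if (j < h + i)%N then a j else
                     if j == (h + i)%N then eval t a (h + i)
                     else a (j + leaves t).-1) h.
Proof.
elim: s i h => [|o l IHl r IHr] i h /=.
  by case: i => // _; rewrite addn0 ltnn eqxx.
move=> lt_i; case: ltnP => [lt_il|le_li] /=.
  rewrite IHl //; congr mul; rewrite leaves_graft //.
  set b := (X in _ = eval r X _).
  have -> : eval r b (h + leaves l) = eval r (fun j => a (j + leaves t).-1) (h + leaves l).
    apply: eval_local => j /andP[le_j _]; rewrite /b.
    by case: ltnP => [|_]; [lia | case: eqP => [|//]; lia].
  have leaves_t := leaves_gt0 t.
  have -> : (h + (leaves l + leaves t).-1 = (leaves t).-1 + (h + leaves l))%N by lia.
  by rewrite eval_shift; apply: eval_local => j _; congr a; lia.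
congr mul.
  by apply: eval_local => j /andP[_ lt_j]; case: ltnP => //; lia.
rewrite IHr; last by lia.
by rewrite -addnA subnKC.
Qed.

Hypothesis mulP : forall o, bilinear2 (mul o).

Lemma eval_sum t i j I (e : I -> A) (c : I -> k) (s : seq I) a :
    (i <= j < i + leaves t)%N ->
  eval t (fun h => if h == j then \sum_(x <- s) c x *: e x else a h) i =
    \sum_(x <- s) c x *: eval t (fun h => if h == j then e x else a h) i.
Proof.
elim: t i => [|o l IHl r IHr] i /= lt_j.
  have -> : i = j by lia.
  by rewrite eqxx.
have [lt_jl|le_lj] := ltnP j (i + leaves l).
  rewrite IHl ?(bil_suml (mulP o)); last by lia.
  apply: eq_bigr => x _; rewrite bilZl //; congr (_ *: mul _ _ _).
  by apply: eval_local => h lt_h; case: eqP => //; lia.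
rewrite IHr ?(bil_sumr (mulP o)); last by lia.
apply: eq_bigr => x _; rewrite bilZr //; congr (_ *: mul _ _ _).
by apply: eval_local => h lt_h; case: eqP => //; lia.
Qed.

End Evaluation.

Definition X_algebra (k : fieldType) (eps : k) (A : lmodType k)
    (mul : binop -> A -> A -> A) : Prop :=
  (forall o, bilinear2 (mul o)) /\
  (forall r a, r \in X_relations eps ->
     ext (fun t => eval mul t a 0) r.1 = ext (fun t => eval mul t a 0) r.2).

(** The operations that vanish on [A] for all arguments form an operadic ideal containing the
    relations, hence containing the ideal they generate. *)
Lemma eval_X_ideal (k : fieldType) (eps : k) (A : lmodType k) mul :
    @X_algebra k eps A mul ->
  forall n (f : freeop k n) a,
    f \in X_ideal eps n -> ext (fun t => eval mul t a 0) f = 0.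
Proof.
move=> [mulP relP] n f a /generated_idealP fI.
pose P m (g : freeop k m) := forall a, ext (fun t => eval mul t a 0) g = 0.
have /(_ _)/cid-/all_tag[J JP] m : exists U : {vspace freeop k m}, forall g, g \in U <-> P m g.
  apply: vspace_of_submod => [b|c u v Pu Pv b]; first by rewrite linear0.
  by rewrite linearP /= Pu Pv scaler0 addr0.
apply/JP: a; apply: fI => [|_ /mapP[r rI ->]]; last first.
  by apply/JP => a; rewrite linearB /= relP // subrr.
split=> m' m g i h lt_i /JP gP; apply/JP => a; rewrite ext_opcomp //.
  rewrite exchange_big big1 //= => t _.
  under eq_bigr => s _ do
    rewrite mulrC -scalerA eval_graft ?(eqP (valP s)) // (eqP (valP t)) add0n.
  by rewrite -scaler_sumr; apply: etrans (scaler0 _ (h t)); congr (_ *: _); apply: gP.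
rewrite big1 //= => s _.
under eq_bigr => t _ do
  rewrite -scalerA eval_graft ?(eqP (valP s)) // (eqP (valP t)) add0n.
rewrite -scaler_sumr; pose b j := if (j < i)%N then a j else a (j + m).-1.
rewrite [X in _ *: X](_ : _ = 0) ?scaler0 //.
have sum0 : \sum_(t : ntree m) h t *: eval mul t a i = 0.
  rewrite -[RHS](gP (fun j => a (i + j)%N)); apply: eq_bigr => t _.
  by rewrite -eval_shift addn0.
have lt_i0 : (0 <= i < 0 + leaves s)%N by rewrite (eqP (valP s)).
transitivity (\sum_(t : ntree m)
    h t *: eval mul s (fun j => if j == i then eval mul t a i else b j) 0).
  apply: eq_bigr => t _; congr (_ *: _); apply: eval_local => j _; rewrite /b.
  by case: ltngtP.
rewrite -(eval_sum mulP) // sum0.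
(* Multilinearity for the empty sum: a tree with argument 0 at one leaf evaluates to 0. *)
by have := eval_sum mulP (fun _ : nat => 0) (fun=> 0) [::] b lt_i0; rewrite !big_nil.
Qed.

Section Laws.

Variables (k : fieldType) (eps : k) (A : lmodType k) (mul : binop -> A -> A -> A).

Local Notation x := (mul OpX).
Local Notation y := (mul OpY).
Local Notation z := (mul OpZ).
Local Notation t := (mul OpT).

Record X_laws : Prop := {
  lawxx : forall a b c, x (x a b) c = x a (x b c) + x a (t b c);
  lawxx' : forall a b c, x (x a b) c = x a (y b c) + x a (z b c);
  lawxz : forall a b c, x (z a b) c = z a (x b c) + z a (t b c);
  lawzx : forall a b c, z (x a b) c = z a (z b c) + z a (y b c);
  lawzz : forall a b c, z (z a b) c = z a (z b c) + z a (y b c);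
  lawxt : forall a b c, x (t a b) c = t a (x b c);
  lawxt' : forall a b c, x (t a b) c = t a (z b c);
  lawxy : forall a b c, x (y a b) c = y a (x b c);
  lawzt : forall a b c, z (t a b) c = y a (z b c);
  lawzy : forall a b c, z (y a b) c = y a (z b c);
  lawtt : forall a b c, t (x a b) c + t (t a b) c = t a (t b c);
  lawtt' : forall a b c, t (x a b) c + t (t a b) c = t a (y b c);
  lawtz : forall a b c, t (z a b) c + t (y a b) c = y a (t b c);
  lawyx : forall a b c, y (x a b) c + y (t a b) c = y a (y b c);
  lawyz : forall a b c, y (z a b) c + y (y a b) c = y a (y b c);
  lawyy : forall a b c,
    y (z a b) c - y (x a b) c = eps *: (x a (t b c) - x a (y b c))
}.

Let evl o o' a : ext (fun u => eval mul u a 0) (lmon k o o') =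
  mul o (mul o' (a 0) (a 1)) (a 2).
Proof. exact: ext_monomial. Qed.
Let evr o o' a : ext (fun u => eval mul u a 0) (rmon k o o') =
  mul o (a 0) (mul o' (a 1) (a 2)).
Proof. exact: ext_monomial. Qed.

Lemma X_laws_algebra : (forall o, bilinear2 (mul o)) -> X_laws -> X_algebra eps mul.
Proof.
move=> mulP L; split=> // r a; rewrite /X_relations.
(* The monomials are generalised, so that they are known only through their values and
   simplification exposes nothing but the entries of the list. *)
move: (lmon k) (rmon k) evl evr => lm rm lmE rmE /(nthP (0, 0))[i + <-].
case: i => [_ /=|i].
  by rewrite extD !(lmE, rmE); apply: lawxx.
case: i => [_ /=|i].
  by rewrite extD !(lmE, rmE); apply: lawxx'.
case: i => [_ /=|i].
  by rewrite extD !(lmE, rmE); apply: lawxz.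
case: i => [_ /=|i].
  by rewrite extD !(lmE, rmE); apply: lawzx.
case: i => [_ /=|i].
  by rewrite extD !(lmE, rmE); apply: lawzz.
case: i => [_ /=|i].
  by rewrite !(lmE, rmE); apply: lawxt.
case: i => [_ /=|i].
  by rewrite !(lmE, rmE); apply: lawxt'.
case: i => [_ /=|i].
  by rewrite !(lmE, rmE); apply: lawxy.
case: i => [_ /=|i].
  by rewrite !(lmE, rmE); apply: lawzt.
case: i => [_ /=|i].
  by rewrite !(lmE, rmE); apply: lawzy.
case: i => [_ /=|i].
  by rewrite extD !(lmE, rmE); apply: lawtt.
case: i => [_ /=|i].
  by rewrite extD !(lmE, rmE); apply: lawtt'.
case: i => [_ /=|i].
  by rewrite extD !(lmE, rmE); apply: lawtz.
case: i => [_ /=|i].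
  by rewrite extD !(lmE, rmE); apply: lawyx.
case: i => [_ /=|i].
  by rewrite extD !(lmE, rmE); apply: lawyz.
case: i => [_ /=|i].
  by rewrite extZ !extB !(lmE, rmE); apply: lawyy.
by [].
Qed.

Lemma X_algebra_laws : X_algebra eps mul -> X_laws.
Proof.
move=> [_]; rewrite /X_relations.
move: (lmon k) (rmon k) evl evr => lm rm lmE rmE relP.
have rel i a b c := relP _ (nth 0 [:: a; b; c]) (mem_nth (0, 0) i).
split=> a b c.
- by have := rel 0%N isT a b c; rewrite /= extD !(lmE, rmE).
- by have := rel 1%N isT a b c; rewrite /= extD !(lmE, rmE).
- by have := rel 2%N isT a b c; rewrite /= extD !(lmE, rmE).
- by have := rel 3%N isT a b c; rewrite /= extD !(lmE, rmE).
- by have := rel 4%N isT a b c; rewrite /= extD !(lmE, rmE).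
- by have := rel 5%N isT a b c; rewrite /= !(lmE, rmE).
- by have := rel 6%N isT a b c; rewrite /= !(lmE, rmE).
- by have := rel 7%N isT a b c; rewrite /= !(lmE, rmE).
- by have := rel 8%N isT a b c; rewrite /= !(lmE, rmE).
- by have := rel 9%N isT a b c; rewrite /= !(lmE, rmE).
- by have := rel 10%N isT a b c; rewrite /= extD !(lmE, rmE).
- by have := rel 11%N isT a b c; rewrite /= extD !(lmE, rmE).
- by have := rel 12%N isT a b c; rewrite /= extD !(lmE, rmE).
- by have := rel 13%N isT a b c; rewrite /= extD !(lmE, rmE).
- by have := rel 14%N isT a b c; rewrite /= extD !(lmE, rmE).
- by have := rel 15%N isT a b c; rewrite /= extZ !extB !(lmE, rmE).
Qed.

End Laws.

Section Trilinear.

Variables (k : fieldType) (A B V : lmodType k).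

Definition trilinear (F : A -> A -> A -> V) :=
  [/\ forall b c, linear (fun a => F a b c), forall a c, linear (fun b => F a b c)
    & forall a b, linear (fun c => F a b c)].

Lemma trilinearD F G : trilinear F -> trilinear G ->
  trilinear (fun a b c => F a b c + G a b c).
Proof.
move=> [F1 F2 F3] [G1 G2 G3].
by split=> u v c a b; rewrite ?(F1, F2, F3) ?(G1, G2, G3) scalerDr addrACA.
Qed.

End Trilinear.

Lemma trilinear_l (k : fieldType) (A : lmodType k) (m m' : A -> A -> A) :
  bilinear2 m -> bilinear2 m' -> trilinear (fun a b c => m (m' a b) c).
Proof.
move=> mP mP'; split=> u v c a b; first by rewrite mP'.1 mP.1.
  by rewrite mP'.2 mP.1.
by rewrite mP.2.
Qed.

Lemma trilinear_r (k : fieldType) (A : lmodType k) (m m' : A -> A -> A) :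
  bilinear2 m -> bilinear2 m' -> trilinear (fun a b c => m a (m' b c)).
Proof.
move=> mP mP'; split=> u v c a b; first by rewrite mP.1.
  by rewrite mP'.1 mP.2.
by rewrite mP'.2 mP.2.
Qed.

Lemma tr_ind3 (k : fieldType) (T : countType) (s : seq T) (V : lmodType k)
    (F G : trunc k s -> trunc k s -> trunc k s -> V) :
    trilinear F -> trilinear G ->
    (forall t u v, t \in s -> u \in s -> v \in s ->
       F (tr_basis k s t) (tr_basis k s u) (tr_basis k s v) =
       G (tr_basis k s t) (tr_basis k s u) (tr_basis k s v)) ->
  forall a b c, F a b c = G a b c.
Proof.
move=> [F1 F2 F3] [G1 G2 G3] FG a b c.
move: a; apply: tr_ind => // t st; move: b; apply: tr_ind => // u su.
by move: c; apply: tr_ind => // v sv; apply: FG.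
Qed.

(** * The free dendriform algebra *)

(** The associative product of Loday and Ronco on planar binary trees, as the list of its terms,
    with unit [Bnil]. Its two halves, according to which factor provides the root, are [prec] and
    [succ]. *)
Fixpoint star (T : bt) : bt -> seq bt :=
  match T with
  | Bnil => fun T' => [:: T']
  | Bnode l r =>
      fix starT (T' : bt) : seq bt :=
        match T' with
        | Bnil => [:: Bnode l r]
        | Bnode l' r' =>
            [seq Bnode l u | u <- star r T'] ++ [seq Bnode u r' | u <- starT l']
        end
  end.
Arguments star : simpl never.

Definition prec (T T' : bt) : seq bt :=
  if T is Bnode l r then [seq Bnode l u | u <- star r T'] else [::].
Definition succ (T T' : bt) : seq bt :=
  if T' is Bnode l r then [seq Bnode u r | u <- star T l] else [::].

Arguments prec : simpl never.
Arguments succ : simpl never.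

Lemma starT0 T : star T Bnil = [:: T].
Proof. by case: T. Qed.
Lemma star0T T : star Bnil T = [:: T].
Proof. by []. Qed.
Lemma starE T T' : T != Bnil -> T' != Bnil -> star T T' = prec T T' ++ succ T T'.
Proof. by case: T => // l r; case: T'. Qed.

Lemma nodes_star T T' u : u \in star T T' -> nodes u = (nodes T + nodes T')%N.
Proof.
elim: T T' u => [|l IHl r IHr] T' u; first by rewrite star0T inE => /eqP->.
elim: T' u => [|l' IHl' r' _] u; first by rewrite starT0 addn0 inE => /eqP->.
rewrite starE // mem_cat => /orP[] /mapP[v].
  by move/IHr => def_v -> /=; rewrite def_v /= addnA.
by move/IHl' => def_v -> /=; rewrite def_v /= -!(addnS, addSn) addnA.
Qed.

Lemma nodes_prec T T' u : u \in prec T T' -> nodes u = (nodes T + nodes T')%N.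
Proof.
by case: T => // l r /mapP[v /nodes_star def_v ->]; rewrite /= def_v addSn addnA.
Qed.

Lemma nodes_succ T T' u : u \in succ T T' -> nodes u = (nodes T + nodes T')%N.
Proof.
by case: T' => // l r /mapP[v /nodes_star def_v ->]; rewrite /= def_v addnS addnA.
Qed.

Lemma star_neq0 T T' u : (T != Bnil) || (T' != Bnil) -> u \in star T T' -> u != Bnil.
Proof.
rewrite -!nodes_eq0 => nz /nodes_star ->.
by rewrite addn_eq0 negb_and.
Qed.

Section StarSums.

Variables (V : zmodType).
Implicit Types (G : bt -> V).

Lemma sum_star T T' G : T != Bnil -> T' != Bnil ->
  \sum_(u <- star T T') G u =
    \sum_(u <- prec T T') G u + \sum_(u <- succ T T') G u.
Proof. by move=> nT nT'; rewrite starE // big_cat. Qed.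

Lemma sum_prec l r T' G :
  \sum_(u <- prec (Bnode l r) T') G u = \sum_(u <- star r T') G (Bnode l u).
Proof. by rewrite big_map. Qed.
Lemma sum_succ T l r G :
  \sum_(u <- succ T (Bnode l r)) G u = \sum_(u <- star T l) G (Bnode u r).
Proof. by rewrite big_map. Qed.

(** Both sides split into three parts, according to which of the three trees provides the root. The
    outer parts are the induction hypotheses on a subtree; in the middle part the two products do
    not interact. Summing an arbitrary [G] replaces equality of lists up to order. *)
Lemma starA T T' T'' G :
  \sum_(u <- star T T') \sum_(w <- star u T'') G w =
  \sum_(u <- star T' T'') \sum_(w <- star T u) G w.
Proof.
elim: T T' T'' G => [|l _ r IHr] T' T'' G.
  by rewrite star0T big_seq1; apply: eq_bigr => u _; rewrite star0T big_seq1.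
case: (eqVneq T' Bnil) => [->|nT']; first by rewrite starT0 star0T !big_seq1.
elim: T'' T' nT' G => [|l'' IHl'' r'' _] T' nT' G.
  by rewrite starT0 big_seq1; apply: eq_bigr => u _; rewrite starT0 big_seq1.
set T := Bnode l r; set T'' := Bnode l'' r''.
have nz u : u \in star T T' -> u != Bnil by apply: star_neq0.
have nz' u : u \in star T' T'' -> u != Bnil by apply: star_neq0; rewrite orbT.
rewrite (eq_big_seq _ (fun u su => sum_star G (nz u su) (isT : T'' != Bnil))).
rewrite [RHS](eq_big_seq _ (fun u su => sum_star G (isT : T != Bnil) (nz' u su))).
rewrite !big_split /= [X in X + _ = _]sum_star // [X in _ = _ + X]sum_star //.
rewrite -addrA; congr (_ + (_ + _)).
- rewrite sum_prec; under [LHS]eq_bigr => u _ do rewrite sum_prec.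
  by rewrite IHr; apply: eq_bigr => u _; rewrite sum_prec.
- case: (T') nT' => // l' r' _; rewrite sum_succ sum_prec.
  under [LHS]eq_bigr => u _ do rewrite sum_prec.
  by rewrite exchange_big; apply: eq_bigr => u _; rewrite sum_succ.
under [LHS]eq_bigr => u _ do rewrite sum_succ.
by rewrite IHl'' // sum_succ; apply: eq_bigr => u _; rewrite sum_succ.
Qed.

End StarSums.

Section Dendriform.

Variables (k : fieldType) (N : nat).

Definition dend_terms : seq bt := flatten [seq bts n | n <- iota 1 N].

Lemma mem_dend_terms T : (T \in dend_terms) = (0 < nodes T <= N)%N.
Proof.
apply/flatten_mapP/idP => [[n]|lt_T].
  by rewrite mem_iota mem_bts add1n ltnS => le_n /eqP->.
by exists (nodes T); rewrite ?mem_bts // mem_iota add1n ltnS.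
Qed.

Definition Dend := trunc k dend_terms.
Definition dbasis : bt -> Dend := tr_basis k dend_terms.
Definition pre : Dend -> Dend -> Dend := tr_mul prec.
Definition suc : Dend -> Dend -> Dend := tr_mul succ.

Lemma pre_bilinear : bilinear2 pre. Proof. exact: tr_mul_bilinear. Qed.
Lemma suc_bilinear : bilinear2 suc. Proof. exact: tr_mul_bilinear. Qed.

Lemma dbasis0 T : (N < nodes T)%N -> dbasis T = 0.
Proof. by move=> lt_T; apply: tr_basis0; rewrite mem_dend_terms; lia. Qed.

(** Truncation is harmless because numbers of nodes add up: a factor with more than [N] nodes is 0,
    and so is every term of its products. *)
Lemma tr_mul_dbasis b T T' : T != Bnil -> T' != Bnil ->
    {in b T T', forall u, nodes u = nodes T + nodes T'}%N ->
  tr_mul b (dbasis T) (dbasis T') = \sum_(u <- b T T') dbasis u.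
Proof.
rewrite -!nodes_eq0 => nT nT' bP.
have [le_N|lt_N] := leqP (nodes T + nodes T') N.
  by rewrite tr_mul_basis // mem_dend_terms; lia.
have [le_T|lt_T] := leqP (nodes T) N; last first.
  rewrite (dbasis0 lt_T) (bil0l (@tr_mul_bilinear _ _ _ _)) big_seq big1 // => u /bP def_u.
  by rewrite dbasis0 // def_u; lia.
have [le_T'|lt_T'] := leqP (nodes T') N; last first.
  rewrite (dbasis0 lt_T') (bil0r (@tr_mul_bilinear _ _ _ _)) big_seq big1 // => u /bP def_u.
  by rewrite dbasis0 // def_u; lia.
by rewrite tr_mul_basis // mem_dend_terms; lia.
Qed.

Lemma pre_basis T T' : T != Bnil -> T' != Bnil ->
  pre (dbasis T) (dbasis T') = \sum_(u <- prec T T') dbasis u.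
Proof. by move=> nT nT'; apply: tr_mul_dbasis => // u; apply: nodes_prec. Qed.

Lemma suc_basis T T' : T != Bnil -> T' != Bnil ->
  suc (dbasis T) (dbasis T') = \sum_(u <- succ T T') dbasis u.
Proof. by move=> nT nT'; apply: tr_mul_dbasis => // u; apply: nodes_succ. Qed.

Let nodes_gt0 T : T \in dend_terms -> T != Bnil.
Proof. by rewrite mem_dend_terms -nodes_eq0; lia. Qed.

Let star_basis T T' : T != Bnil -> T' != Bnil ->
  pre (dbasis T) (dbasis T') + suc (dbasis T) (dbasis T') =
    \sum_(u <- star T T') dbasis u.
Proof. by move=> nT nT'; rewrite pre_basis // suc_basis // -sum_star. Qed.

Let prec_neq0 T T' u : T != Bnil -> u \in prec T T' -> u != Bnil.
Proof. by case: T => // l r _ /mapP[v _ ->]. Qed.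
Let succ_neq0 T T' u : T' != Bnil -> u \in succ T T' -> u != Bnil.
Proof. by case: T' => // l r _ /mapP[v _ ->]. Qed.

(** With [pre_suc] and [suc_suc], these are the dendriform axioms. On basis trees the root comes
    from [a], [b] and [c] respectively: the outer two reduce to [starA] in one subtree of that root,
    the middle one to an exchange of sums. *)
Lemma pre_pre a b c : pre (pre a b) c = pre a (pre b c + suc b c).
Proof.
rewrite bilDr; last exact: pre_bilinear.
move: a b c; apply: tr_ind3 => [||T T' T'' /nodes_gt0 nT /nodes_gt0 nT' /nodes_gt0 nT''].
- exact: trilinear_l pre_bilinear pre_bilinear.
- by apply: trilinearD; apply: trilinear_r; (exact: pre_bilinear || exact: suc_bilinear).
rewrite -!/(dbasis _) -bilDr ?star_basis; try exact: pre_bilinear; rewrite ?pre_basis //.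
rewrite (bil_suml pre_bilinear) (bil_sumr pre_bilinear).
rewrite (eq_big_seq _ (fun u su => pre_basis (prec_neq0 nT su) nT'')).
have nz u : u \in star T' T'' -> u != Bnil by apply: star_neq0; rewrite nT'.
rewrite [RHS](eq_big_seq _ (fun u su => pre_basis nT (nz u su))).
case: T nT => // l r _; rewrite sum_prec.
under [LHS]eq_bigr do rewrite sum_prec.
by rewrite starA; apply: eq_bigr => u _; rewrite sum_prec.
Qed.

Lemma pre_suc a b c : pre (suc a b) c = suc a (pre b c).
Proof.
move: a b c; apply: tr_ind3 => [||T T' T'' /nodes_gt0 nT /nodes_gt0 nT' /nodes_gt0 nT''].
- exact: trilinear_l pre_bilinear suc_bilinear.
- exact: trilinear_r suc_bilinear pre_bilinear.
rewrite -!/(dbasis _) ?pre_basis ?suc_basis //.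
rewrite (bil_suml pre_bilinear) (bil_sumr suc_bilinear).
rewrite (eq_big_seq _ (fun u su => pre_basis (succ_neq0 nT' su) nT'')).
rewrite [RHS](eq_big_seq _ (fun u su => suc_basis nT (prec_neq0 nT' su))).
case: T' nT' => // l r _; rewrite sum_succ sum_prec.
under [LHS]eq_bigr do rewrite sum_prec.
by rewrite exchange_big; apply: eq_bigr => u _; rewrite sum_succ.
Qed.

Lemma suc_suc a b c : suc (pre a b + suc a b) c = suc a (suc b c).
Proof.
rewrite bilDl; last exact: suc_bilinear.
move: a b c; apply: tr_ind3 => [||T T' T'' /nodes_gt0 nT /nodes_gt0 nT' /nodes_gt0 nT''].
- by apply: trilinearD; apply: trilinear_l; (exact: pre_bilinear || exact: suc_bilinear).
- exact: trilinear_r suc_bilinear suc_bilinear.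
rewrite -!/(dbasis _) -bilDl ?star_basis ?suc_basis //; try exact: suc_bilinear.
rewrite (bil_suml suc_bilinear) (bil_sumr suc_bilinear).
have nz u : u \in star T T' -> u != Bnil by apply: star_neq0; rewrite nT.
rewrite (eq_big_seq _ (fun u su => suc_basis (nz u su) nT'')).
rewrite [RHS](eq_big_seq _ (fun u su => suc_basis nT (succ_neq0 nT'' su))).
case: T'' nT'' => // l r _; rewrite sum_succ.
under [LHS]eq_bigr do rewrite sum_succ.
by rewrite starA; apply: eq_bigr => u _; rewrite sum_succ.
Qed.

End Dendriform.

(** * The marked dendriform model *)

Definition dop (o : binop) : bt -> bt -> seq bt :=
  match o with OpX | OpZ => prec | OpY | OpT => succ end.

Fixpoint dend (t : tree) : seq bt :=
  if t is Node o l r then flatten [seq dop o T T' | T <- dend l, T' <- dend r]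
  else [:: Bnode Bnil Bnil].

Definition marks_left (o : binop) : bool :=
  match o with OpX | OpT => true | OpY | OpZ => false end.

Fixpoint mark (t : tree) : nat :=
  if t is Node o l r then if marks_left o then mark l else (leaves l + mark r)%N
  else 0%N.

Lemma lt_mark t : (mark t < leaves t)%N.
Proof. by elim: t => //= o l IHl r IHr; case: ifP => _; lia. Qed.

Lemma nodes_dend t T : T \in dend t -> nodes T = leaves t.
Proof.
elim: t T => [|o l IHl r IHr] T /=; first by rewrite inE => /eqP->.
move/flattenP=> [_ /allpairsP[[T1 T2] [/= /IHl <- /IHr <- ->]]].
by case: o; rewrite /dop; try exact: nodes_prec; exact: nodes_succ.
Qed.

Lemma dend_neq0 t T : T \in dend t -> T != Bnil.
Proof. by move/nodes_dend; rewrite -nodes_eq0 => ->; rewrite -lt0n leaves_gt0. Qed.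

Lemma sum_dend_node (V : zmodType) o l r (G : bt -> V) :
  \sum_(u <- dend (Node o l r)) G u =
    \sum_(T <- dend l) \sum_(T' <- dend r) \sum_(u <- dop o T T') G u.
Proof. by rewrite /= big_flatten /= big_allpairs_dep. Qed.

Section MarkedDendriform.

Variables (k : fieldType) (n : nat).

(** Marks are labels that the products carry along unshifted. Since [marker] gives distinct labels
    to distinct leaves, the label that survives names the marked leaf. *)
Definition Marked := {ffun 'I_n -> trunc k (dend_terms n)}.
HB.instance Definition _ := GRing.Lmodule.on Marked.

Definition forget (a : Marked) : Dend k n := \sum_i a i.

Definition mulM (o : binop) (a b : Marked) : Marked :=
  match o with
  | OpX => [ffun i => pre (a i) (forget b)]
  | OpT => [ffun i => suc (a i) (forget b)]
  | OpZ => [ffun i => pre (forget a) (b i)]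
  | OpY => [ffun i => suc (forget a) (b i)]
  end.

Lemma forget_linear c a b : forget (c *: a + b) = c *: forget a + forget b.
Proof.
by rewrite /forget scaler_sumr -big_split; apply: eq_bigr => i _; rewrite !ffunE.
Qed.

Lemma mulM_bilinear o : bilinear2 (mulM o).
Proof.
have [[pl pr] [sl sr]] := (pre_bilinear k n, suc_bilinear k n).
by split=> c a a' b; apply/ffunP=> i; case: o;
  rewrite !ffunE ?forget_linear ?(pl, pr, sl, sr).
Qed.

Lemma forget_mulM o a b : forget (mulM o a b) =
  match o with
  | OpX | OpZ => pre (forget a) (forget b)
  | OpY | OpT => suc (forget a) (forget b)
  end.
Proof.
have [bp bs] := (pre_bilinear k n, suc_bilinear k n).
by case: o; rewrite {1}/forget; under [LHS]eq_bigr do rewrite ffunE;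
  rewrite -?(bil_suml bp) -?(bil_suml bs) -?(bil_sumr bp) -?(bil_sumr bs).
Qed.

(** For each label these are the dendriform axioms. [lawyy] holds whatever [eps] is: [y] forgets the
    labels of its left factor and [x] those of its right one, so both sides are 0. *)
Lemma mulM_laws eps : X_laws eps mulM.
Proof.
have [bp bs] := (pre_bilinear k n, suc_bilinear k n).
by split=> a b c; apply/ffunP=> i;
  rewrite !(ffunE, forget_mulM) ?forget_mulM ?pre_pre ?pre_suc -?suc_suc
    ?(bilDl bp, bilDr bp, bilDl bs, bilDr bs) ?subrr ?scaler0 // addrC.
Qed.

Definition marker (i : nat) : Marked :=
  [ffun j : 'I_n => if j == i :> nat then dbasis k n (Bnode Bnil Bnil) else 0].

Lemma eval_marker t i : (i + leaves t <= n)%N ->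
  eval mulM t marker i =
    [ffun j : 'I_n => if j == (i + mark t)%N :> nat
                      then \sum_(T <- dend t) dbasis k n T else 0].
Proof.
have [bp bs] := (pre_bilinear k n, suc_bilinear k n).
elim: t i => [|o l IHl r IHr] i /= le_n.
  by apply/ffunP=> j; rewrite !ffunE addn0 big_seq1.
rewrite IHl; last by lia.
rewrite IHr; last by lia.
have forgetE (h : nat) (e : Dend k n) :
    (h < n)%N -> forget [ffun j : 'I_n => if j == h :> nat then e else 0] = e.
  move=> lt_h; rewrite /forget; under eq_bigr do rewrite ffunE.
  by rewrite -big_mkcond (big_pred1 (Ordinal lt_h)).
have lt_l := lt_mark l; have lt_r := lt_mark r.
have pre_sum : pre (\sum_(T <- dend l) dbasis k n T) (\sum_(T <- dend r) dbasis k n T) =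
    \sum_(T <- dend l) \sum_(T' <- dend r) \sum_(u <- prec T T') dbasis k n u.
  rewrite (bil_suml bp); apply: eq_big_seq => T /dend_neq0 nT.
  by rewrite (bil_sumr bp); apply: eq_big_seq => T' /dend_neq0 nT'; rewrite pre_basis.
have suc_sum : suc (\sum_(T <- dend l) dbasis k n T) (\sum_(T <- dend r) dbasis k n T) =
    \sum_(T <- dend l) \sum_(T' <- dend r) \sum_(u <- succ T T') dbasis k n u.
  rewrite (bil_suml bs); apply: eq_big_seq => T /dend_neq0 nT.
  by rewrite (bil_sumr bs); apply: eq_big_seq => T' /dend_neq0 nT'; rewrite suc_basis.
rewrite -[flatten _]/(dend (Node o l r)) sum_dend_node.
apply/ffunP=> j; case: o; rewrite !ffunE /= forgetE ?addnA; try lia; case: eqP => _;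
  by rewrite ?(bil0l bp, bil0r bp, bil0l bs, bil0r bs) ?pre_sum ?suc_sum.
Qed.

End MarkedDendriform.

Section MarkedSupport.

Variables (k : fieldType) (n : nat).

Definition dcoord (t : tree) : {ffun 'I_n * seq_sub (bts n) -> k^o} :=
  [ffun v : 'I_n * seq_sub (bts n) =>
     ((v.1 == mark t :> nat) * count_mem (ssval v.2) (dend t))%:R].

(** Evaluation at the generic arguments [marker] vanishes on the ideal, and [dcoord] reads off its
    components. *)
Lemma dcoord_X_ideal eps (f : freeop k n) : f \in X_ideal eps n -> ext dcoord f = 0.
Proof.
move=> fI; have MX := X_laws_algebra (@mulM_bilinear k n) (@mulM_laws k n eps).
have := eval_X_ideal MX (@marker k n) fI; rewrite /ext => f0.
apply/ffunP=> -[i [T sT]]; rewrite sum_ffunE ffunE.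
have T_terms : T \in dend_terms n.
  move: (sT); rewrite mem_dend_terms mem_bts => /eqP->.
  by rewrite leqnn andbT; case: (n) i => // -[].
have := congr1 (fun g : Marked k n => g i (SeqSub T_terms)) f0.
rewrite /= sum_ffunE sum_ffunE !ffunE => {2}<-; apply: eq_bigr => t _.
rewrite eval_marker ?add0n ?(eqP (valP t)) // !ffunE /=; congr (_ *: _).
case: eqP => _; rewrite ?mul0n ?ffunE // mul1n sum_ffunE.
elim: (dend t) => [|u s IHs]; first by rewrite big_nil.
by rewrite big_cons /= natrD IHs ffunE eq_sym.
Qed.

End MarkedSupport.

(** * The obstruction [kap] *)

Section Kappa.

Variables (k : fieldType) (eps : k) (A : lmodType k) (mul : binop -> A -> A -> A).
Hypotheses (mulP : forall o, bilinear2 (mul o)) (L : X_laws eps mul).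
Hypothesis eps2 : eps * eps = 1.

Local Notation x := (mul OpX).
Local Notation y := (mul OpY).
Local Notation z := (mul OpZ).
Local Notation t := (mul OpT).

(** [dl] and [ep] are differences of elements with the same tree and different marks, so a product
    that forgets the mark of that factor should kill them. The laws imply this for [z] on the left
    and [t] on the right; the products by [y] on the left and [x] on the right are all [kap] up to a
    sign and [eps]. *)
Definition dl a b := x a b - z a b.
Definition ep a b := t a b - y a b.
Definition kap a b c := y (dl a b) c.

Let mBl o a b c : mul o (a - b) c = mul o a c - mul o b c.
Proof. exact: bilBl. Qed.
Let mBr o a b c : mul o c (a - b) = mul o c a - mul o c b.
Proof. exact: bilBr. Qed.
Let mDl o a b c : mul o (a + b) c = mul o a c + mul o b c.
Proof. exact: bilDl. Qed.
Let mDr o a b c : mul o c (a + b) = mul o c a + mul o c b.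
Proof. exact: bilDr. Qed.
Let m0l o a : mul o 0 a = 0. Proof. exact: bil0l. Qed.
Let m0r o a : mul o a 0 = 0. Proof. exact: bil0r. Qed.
Let mZl o c a b : mul o (c *: a) b = c *: mul o a b. Proof. exact: bilZl. Qed.
Let mZr o c a b : mul o a (c *: b) = c *: mul o a b. Proof. exact: bilZr. Qed.
Let mNl o a b : mul o (- a) b = - mul o a b. Proof. exact: bilNl. Qed.
Let mNr o a b : mul o a (- b) = - mul o a b. Proof. exact: bilNr. Qed.

Let sub4 (a b c d : A) : a + b = c + d -> b - d = c - a.
Proof. by move=> E; apply/eqP; rewrite subr_eq addrAC -E addrAC subrr add0r. Qed.

Lemma z_dl a b c : z (dl a b) c = 0.
Proof. by rewrite /dl mBl (lawzx L) (lawzz L) subrr. Qed.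
Lemma z_ep a b c : z (ep a b) c = 0.
Proof. by rewrite /ep mBl (lawzt L) (lawzy L) subrr. Qed.
Lemma t_dl a b c : t a (dl b c) = 0.
Proof. by rewrite /dl mBr -(lawxt L) -(lawxt' L) subrr. Qed.
Lemma t_ep a b c : t a (ep b c) = 0.
Proof. by rewrite /ep mBr -(lawtt L) -(lawtt' L) subrr. Qed.
Lemma y_ep a b c : y (ep a b) c = - kap a b c.
Proof.
rewrite /kap /ep /dl !mBl opprB; apply: sub4.
by rewrite (lawyx L) (lawyz L).
Qed.

Let x_dl_ep a b c : x a (dl b c) = - x a (ep b c).
Proof.
rewrite /ep /dl !mBr opprB; apply: sub4.
by rewrite addrC -(lawxx L) (lawxx' L).
Qed.

(** [lawyy] identifies the defect in the left factor with the one in the right factor. This is the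
    only source of [eps] below. *)
Lemma kapE a b c : kap a b c = eps *: x a (dl b c).
Proof.
apply: oppr_inj; rewrite /kap {1}/dl mBl opprB (lawyy L) -mBr.
by rewrite -/(ep b c) x_dl_ep scalerN opprK.
Qed.

Lemma x_dl a b c : x a (dl b c) = eps *: kap a b c.
Proof. by rewrite kapE scalerA eps2 scale1r. Qed.

Lemma x_ep a b c : x a (ep b c) = - (eps *: kap a b c).
Proof. by rewrite -x_dl x_dl_ep opprK. Qed.

Lemma mul_kap_r o a b c q : mul o a (kap b c q) = kap (mul o a b) c q.
Proof.
rewrite !kapE mZr; congr (_ *: _); case: o.
- by rewrite (lawxx L) t_dl m0r addr0.
- by rewrite (lawxy L).
- by rewrite (lawxz L) t_dl m0r addr0.
- by rewrite (lawxt L).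
Qed.

Lemma mul_kap_l o a b c q : mul o (kap a b c) q = kap a b (mul o c q).
Proof.
rewrite /kap; case: o.
- by rewrite (lawxy L).
- by rewrite -(lawyz L) z_dl m0l add0r.
- by rewrite (lawzy L).
- by rewrite -(lawtz L) z_dl m0l add0r.
Qed.

(** After absorption, [mul o (x a (dl b c)) q] has to be compared with [mul o a (y (dl b c) q)]. A
    law relates them up to terms in [z (dl b c) q] or [t a (dl b c)], which are 0. *)
Lemma kap_mul_r o a b c q : kap a b (mul o c q) = eps *: kap (mul o a b) c q.
Proof.
rewrite -mul_kap_l -mul_kap_r kapE mZl; congr (_ *: _); rewrite /kap; case: o.
- by rewrite (lawxx' L) z_dl m0r addr0.
- apply: (addIr (y (t a (dl b c)) q)).
  by rewrite (lawyx L) t_dl m0l addr0.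
- by rewrite (lawzx L) z_dl m0r add0r.
- apply: (addIr (t (t a (dl b c)) q)).
  by rewrite (lawtt' L) t_dl m0l addr0.
Qed.

Let dlDl a a' b : dl (a + a') b = dl a b + dl a' b.
Proof. by rewrite /dl !mDl opprD addrACA. Qed.
Let dlDr a b b' : dl a (b + b') = dl a b + dl a b'.
Proof. by rewrite /dl !mDr opprD addrACA. Qed.
Let dlNl a b : dl (- a) b = - dl a b.
Proof. by rewrite /dl !mNl opprB opprK addrC. Qed.

Lemma kapDl a a' b c : kap (a + a') b c = kap a b c + kap a' b c.
Proof. by rewrite /kap dlDl mDl. Qed.
Lemma kapDm a b b' c : kap a (b + b') c = kap a b c + kap a b' c.
Proof. by rewrite /kap dlDr mDl. Qed.
Lemma kapDr a b c c' : kap a b (c + c') = kap a b c + kap a b c'.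
Proof. by rewrite /kap mDr. Qed.
Lemma kapNl a b c : kap (- a) b c = - kap a b c.
Proof. by rewrite /kap dlNl mNl. Qed.
Lemma kapNr a b c : kap a b (- c) = - kap a b c.
Proof. by rewrite /kap mNr. Qed.

(* Each [kap a (o b c) q] has two expressions, obtained from the two sides of *)
(* [kapE]; comparing them forces the linear relations between the             *)
(* [kap (o a b) c q] on which the two signs differ.                           *)
Lemma kap_x_r a b c q :
  kap a (x b c) q = kap a b (y c q) + kap a b (z c q).
Proof.
rewrite -kapDr !kapE; congr (_ *: x _ _).
by rewrite {1}/dl (lawxx' L) (lawzx L) [z b _ + _]addrC opprD addrACA -dlDr.
Qed.

Lemma kap_x_l a b c q : kap a (x b c) q = kap (y a b) c q - kap (t a b) c q.
Proof.
have -> : kap (y a b) c q - kap (t a b) c q = - kap (ep a b) c q.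
  by rewrite /ep kapDl kapNl opprB.
rewrite -[LHS]opprK -(y_ep a (x b c)); congr (- _).
have -> : ep a (x b c) = x (ep a b) c by rewrite {1}/ep -(lawxt L) -(lawxy L) -mBl.
by rewrite /kap /dl z_ep subr0.
Qed.

Lemma kap_t_r a b c q : kap a (t b c) q = - kap a b (z c q).
Proof.
have -> : kap a (t b c) q = eps *: x a (ep b (z c q)).
  by rewrite kapE {1}/dl (lawxt' L) (lawzt L).
by rewrite x_ep scalerN scalerA eps2 scale1r.
Qed.

Lemma kap_t_l a b c q : kap a (t b c) q =
  kap (x a b) c q - kap (z a b) c q + (kap (t a b) c q - kap (y a b) c q).
Proof.
rewrite -!kapNl -!kapDl -/(dl a b) -/(ep a b) -[LHS]opprK -(y_ep a (t b c)).
have -> : ep a (t b c) = t (dl a b + ep a b) c.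
  by rewrite {1}/ep -(lawtt L) -(lawtz L) opprD addrACA -!mBl -mDl.
(* The defects of [dl] and [ep] under [y] are opposite, so [y s c = 0] and [t s c] is [ep s c]. The
   proof of [kap_z_r] uses the mirror image, with [x] in place of [y]. *)
set s := dl a b + ep a b.
have ys : y s c = 0 by rewrite mDl y_ep subrr.
by have -> : t s c = ep s c; rewrite ?y_ep ?opprK // /ep ys subr0.
Qed.

Lemma kap_z_l a b c q : kap a (z b c) q = - kap (t a b) c q.
Proof.
rewrite -[LHS]opprK -(y_ep a (z b c)); congr (- y _ q).
by rewrite /ep -(lawxt' L) -(lawzt L).
Qed.

Lemma kap_z_r a b c q : kap a (z b c) q =
  - (kap a b (x c q) - kap a b (z c q) + (kap a b (t c q) - kap a b (y c q))).
Proof.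
rewrite -!kapNr -!kapDr -/(dl c q) -/(ep c q).
have -> : kap a (z b c) q = eps *: x a (z b (dl c q + ep c q)).
  rewrite kapE {1}/dl (lawxz L) (lawzz L) -!mDr -mBr.
  by rewrite opprD addrACA.
set s := dl c q + ep c q.
have xs h : x h s = 0 by rewrite mDr x_dl x_ep subrr.
have -> : z b s = - dl b s by rewrite /dl xs sub0r opprK.
by rewrite mNr scalerN -kapE.
Qed.

Lemma kap_y_r a b c q : kap a (y b c) q = kap a b (x c q) - kap a b (z c q).
Proof.
rewrite -kapNr -kapDr -/(dl c q).
rewrite [LHS]kapE {1}/dl (lawxy L) (lawzy L) -mBr -/(dl c q).
rewrite -[y b _](subKr (t b (dl c q))) -/(ep b _) t_dl sub0r mNr x_ep opprK.
by rewrite scalerA eps2 scale1r.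
Qed.

Lemma kap_yz a b c q : kap a (y b c) q + kap a (z b c) q = kap (x a b) c q.
Proof.
rewrite -kapDm /kap; congr (y _ q).
by rewrite /dl !mDr -(lawxx' L) [z a _ + _]addrC -(lawzx L).
Qed.

End Kappa.

(** For the sign +, a tree acts on [kap] only through this word ([kap_evr]). *)
Fixpoint infix_ops (t : tree) : seq binop :=
  if t is Node o l r then infix_ops l ++ o :: infix_ops r else [::].

Lemma size_infix_ops t : (size (infix_ops t)).+1 = leaves t.
Proof. by elim: t => //= o l <- r <-; rewrite size_cat /= addSn. Qed.

Lemma eval_const (k : fieldType) (A : lmodType k) (mul : binop -> A -> A -> A)
    t v i : eval mul t (fun=> v) i = eval mul t (fun=> v) 0.
Proof. by rewrite -[i]addn0 eval_shift. Qed.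

(** * The sign -: proper composites of [kap] vanish *)

Section KappaMinus.

Variables (k : fieldType) (A : lmodType k) (mul : binop -> A -> A -> A).
Hypotheses (mulP : forall o, bilinear2 (mul o)) (L : X_laws (- 1) mul).
Hypothesis nz2 : 2%:R != 0 :> k.

Let eps2 : (- 1) * (- 1) = 1 :> k. Proof. by rewrite mulrNN mulr1. Qed.
Let addrr_eq0 (a : A) : a + a = 0 -> a = 0.
Proof.
by rewrite -mulr2n -scaler_nat => /eqP; rewrite scaler_eq0 (negPf nz2) => /eqP.
Qed.

(** Moving an operation from the last slot to the first changes the sign, so the two expressions of
    each [kap a (mul o b c) q] give linear equations in the four values X, Y, Z, T named in the
    proof. They yield Z = -T, 2(Y - T) = 0 and 2(X + T) = 0; after division by 2, one more equation
    gives T = 0. *)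
Lemma kap_mul_minus o a b c q : kap mul (mul o a b) c q = 0.
Proof.
have C o' : kap mul a b (mul o' c q) = - kap mul (mul o' a b) c q.
  by rewrite (kap_mul_r mulP L) scaleN1r.
have Ex := etrans (esym (kap_x_r mulP L a b c q)) (kap_x_l mulP L a b c q).
have Et := etrans (esym (kap_t_r mulP L eps2 a b c q)) (kap_t_l mulP L a b c q).
have Ez := etrans (esym (kap_z_l mulP L a b c q)) (kap_z_r mulP L eps2 a b c q).
have Ey := kap_yz mulP L a b c q.
rewrite (kap_y_r mulP L eps2) (kap_z_l mulP L) in Ey.
move: Ex Et Ez Ey; rewrite !C.
set X := kap mul (mul OpX a b) c q; set Y := kap mul (mul OpY a b) c q.
set Z := kap mul (mul OpZ a b) c q; set T := kap mul (mul OpT a b) c q.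
rewrite !opprK => Ex Et Ez Ey.
have ZT : Z = - T.
  by rewrite Ez !opprD !opprK.
have YT : Y = T.
  apply/eqP; rewrite -subr_eq0; apply/eqP/addrr_eq0.
  by rewrite -{1}Ex ZT opprK addrACA addNr subrr addr0.
have XT : X = - T.
  apply/eqP; rewrite -addr_eq0; apply/eqP/addrr_eq0.
  by rewrite -{1}Ey ZT subrK addrACA addNr addNr addr0.
have T0 : T = 0.
  by move: Et; rewrite ZT XT YT opprK addNr subrr addr0 => /eqP; rewrite oppr_eq0 => /eqP.
by case: o; rewrite -/X -/Y -/Z -/T ?XT ?YT ?ZT T0 ?oppr0.
Qed.

(** With more than three leaves some slot contains an operation, which can be brought to the first
    slot. *)
Lemma kap_minus ta tb tc v : (3 < leaves ta + leaves tb + leaves tc)%N ->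
  let ev t := eval mul t (fun=> v) 0 in kap mul (ev ta) (ev tb) (ev tc) = 0.
Proof.
move=> gt3 ev; rewrite /ev; case: ta gt3 => [|o l r] /= gt3; last exact: kap_mul_minus.
case: tc gt3 => [|o l r] /= gt3; last first.
  by rewrite (kap_mul_r mulP L) kap_mul_minus scaler0.
case: tb gt3 => [//|o l r] _ /=; set a := eval mul l _ _; set b := eval mul r _ _.
have K0 o' : kap mul v a (mul o' b v) = 0.
  by rewrite (kap_mul_r mulP L) kap_mul_minus scaler0.
case: o; rewrite ?(kap_x_r mulP L) ?(kap_y_r mulP L eps2) ?(kap_z_l mulP L)
  ?(kap_t_r mulP L eps2).
- by rewrite !K0 addr0.
- by rewrite !K0 subr0.
- by rewrite kap_mul_minus oppr0.
- by rewrite K0 oppr0.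
Qed.

End KappaMinus.

(** * The sign +: composites of [kap] as words *)

Section KappaPlus.

Variables (k : fieldType) (A : lmodType k) (mul : binop -> A -> A -> A).
Hypotheses (mulP : forall o, bilinear2 (mul o)) (L : X_laws 1 mul).

Local Notation x := (mul OpX).
Local Notation y := (mul OpY).
Local Notation z := (mul OpZ).
Local Notation t := (mul OpT).
Local Notation kap := (kap mul).

Let eps2 : 1 * 1 = 1 :> k. Proof. exact: mulr1. Qed.

Let kapC o a b c q : kap a b (mul o c q) = kap (mul o a b) c q.
Proof. by rewrite (kap_mul_r mulP L) scale1r. Qed.

(** The comparison that kills everything for the other sign here yields only this relation and
    [kap_x]. As a consequence, operations move between all three slots ([kapC], [kapM]). *)
Let kap_t a b c q : kap (t a b) c q = - kap (z a b) c q.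
Proof.
have := etrans (esym (kap_x_r mulP L a b c q)) (kap_x_l mulP L a b c q).
by rewrite !kapC => /addrI->; rewrite opprK.
Qed.

Let kap_x a b c q : kap (x a b) c q = kap (y a b) c q + kap (z a b) c q.
Proof.
have := etrans (esym (kap_z_l mulP L a b c q)) (kap_z_r mulP L eps2 a b c q).
rewrite !kapC => /oppr_inj; rewrite addrCA -{1}[kap (t a b) c q]addr0 => /addrI/esym/eqP.
by rewrite addrAC subr_eq0 subr_eq addrC => /eqP.
Qed.

Let kapM o a b c q : kap a (mul o b c) q = kap (mul o a b) c q.
Proof.
case: o.
- by rewrite (kap_x_r mulP L) !kapC -kap_x.
- by rewrite (kap_y_r mulP L eps2) !kapC kap_x addrK.
- by rewrite (kap_z_l mulP L) kap_t opprK.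
- by rewrite (kap_t_r mulP L eps2) kapC -kap_t.
Qed.

Definition is_kap u := exists a b c, u = kap a b c.

Lemma is_kap_mul o u a : is_kap u -> is_kap (mul o u a).
Proof.
by case=> [b [c [d ->]]]; exists b, c, (mul o d a); rewrite (mul_kap_l mulP L).
Qed.

(** Right multiplication of a [kap] by a tree is thus a succession of multiplications by single
    leaves. *)
Lemma kap_mulA o o' u a b : is_kap u -> mul o u (mul o' a b) = mul o' (mul o u a) b.
Proof.
case=> [c [d [e ->]]]; rewrite (mul_kap_l mulP L o) kapC -(mul_kap_l mulP L o').
by rewrite -kapC -(mul_kap_l mulP L).
Qed.

Lemma t_kap u a : is_kap u -> t u a = - z u a.
Proof. by case=> [b [c [d ->]]]; rewrite !(mul_kap_l mulP L) !kapC kap_t. Qed.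

Lemma x_kap u a : is_kap u -> x u a = y u a + z u a.
Proof. by case=> [b [c [d ->]]]; rewrite !(mul_kap_l mulP L) !kapC kap_x. Qed.

(** The laws make [x] and [z], and likewise [t] and [y], agree inside [z _ b]. Since [x] is [y + z]
    on [u], the term in [y] vanishes; since [t] is [- z] on [u], so does the term in [z]. *)
Lemma z_mul_kap o u a b : is_kap u -> z (mul o u a) b = 0.
Proof.
move=> uK; have zD v w : z (v + w) b = z v b + z w b by apply: bilDl.
have zN v : z (- v) b = - z v b by apply: bilNl.
have zx : z (x u a) b = z (z u a) b by rewrite (lawzx L) (lawzz L).
have zt : z (t u a) b = z (y u a) b by rewrite (lawzt L) (lawzy L).
have zy0 : z (y u a) b = 0.
  by move: zx; rewrite x_kap // zD => /eqP; rewrite -subr_eq0 addrK => /eqP.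
have zz0 : z (z u a) b = 0.
  by move: zt; rewrite t_kap // zN zy0 => /eqP; rewrite oppr_eq0 => /eqP.
by case: o; rewrite ?zx ?zt.
Qed.

Lemma t_mul_kap o u a b : is_kap u -> t (mul o u a) b = 0.
Proof. by move=> uK; rewrite t_kap ?z_mul_kap ?oppr0 //; apply: is_kap_mul. Qed.

Lemma mul_t_kap o u a b : is_kap u -> mul o (t u a) b = 0.
Proof.
move=> uK; have xt : x (t u a) b = 0.
  by rewrite (lawxt' L) kap_mulA // z_mul_kap.
case: o => //; rewrite ?z_mul_kap ?t_mul_kap //.
by move: xt; rewrite x_kap ?z_mul_kap ?addr0 //; apply: is_kap_mul.
Qed.

Lemma mul_z_kap o u a b : is_kap u -> mul o (z u a) b = 0.
Proof.
move=> uK; rewrite -[z u a]opprK -t_kap //.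
by rewrite (bilNl (mulP o)) mul_t_kap ?oppr0.
Qed.

Lemma y_mul_kap o u a b : is_kap u -> y (mul o u a) b = x (mul o u a) b.
Proof. by move=> uK; rewrite x_kap ?z_mul_kap ?addr0 //; apply: is_kap_mul. Qed.

Variable v : A.
Let ev s := eval mul s (fun=> v) 0.
Let step u o := mul o u v.

Let evN o l r : ev (Node o l r) = mul o (ev l) (ev r).
Proof. by rewrite /ev /= eval_const. Qed.

Lemma mul_kap_ev o u s : is_kap u -> mul o u (ev s) = foldl step (mul o u v) (infix_ops s).
Proof.
elim: s o u => [|o' l IHl r IHr] o u uK //.
rewrite evN kap_mulA // IHr; last exact: is_kap_mul.
by rewrite IHl //= foldl_cat.
Qed.

Lemma kap_evr a b s : kap a b (ev s) = foldl step (kap a b v) (infix_ops s).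
Proof.
elim: s => [|o l IHl r _] //; rewrite evN -(mul_kap_l mulP L) mul_kap_ev.
  by rewrite IHl foldl_cat.
by exists a, b, (ev l).
Qed.

(** All inner operations are moved into the last slot, which [kap_evr] then unrolls. *)
Lemma kap_ev ta tb tc : exists2 w : seq binop,
  (size w).+3 = (leaves ta + leaves tb + leaves tc)%N &
  kap (ev ta) (ev tb) (ev tc) = foldl step (kap v v v) w.
Proof.
elim: ta tb tc => [|o l IHl r _] tb tc /=; last first.
  have [w sw Ew] := IHl r (Node o tb tc).
  exists w; first by rewrite sw /=; lia.
  by rewrite evN -kapC -evN.
elim: tb tc => [|o l IHl r _] tc /=; last first.
  have [w sw Ew] := IHl (Node o r tc).
  exists w; first by rewrite sw /=; lia.
  by rewrite evN kapM -kapC -evN.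
exists (infix_ops tc); last exact: kap_evr.
by have := size_infix_ops tc; lia.
Qed.

(** A letter [z] or [t] gives 0 and a letter [y] can be replaced by [x]; for the first letter,
    either conclusion needs a second letter. As [kap] itself has arity 3, this is where arity 5
    comes from. *)
Lemma foldl_kap u w : is_kap u -> (1 < size w)%N ->
  foldl step u w = 0 \/ foldl step u w = iter (size w) (fun a => x a v) u.
Proof.
move=> uK; elim/last_ind: w => [|w o IHw] //.
rewrite size_rcons foldl_rcons iterS.
have wK (s : seq binop) : is_kap (foldl step u s).
  by elim/last_ind: s => // s o' IHs; rewrite foldl_rcons; apply: is_kap_mul.
have [gt1 _|] := ltnP 1 (size w).
  case: (IHw gt1) => ->; first by left; apply: (bil0l (mulP o)).
  have iK m : is_kap (iter m (fun a => x a v) u).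
    by elim: m => //= m; apply: is_kap_mul.
  case: (size w) gt1 => // m _; rewrite /step iterS.
  case: o; [by right|by right; apply: y_mul_kap|by left; apply: z_mul_kap|].
  by left; apply: t_mul_kap.
case: w {IHw} => [|o' [|]] //= _ _; rewrite /step.
case: o'; [|rewrite ?(y_mul_kap)|by left; apply: mul_z_kap|by left; apply: mul_t_kap].
  case: o; [by right|by right; apply: y_mul_kap|by left; apply: z_mul_kap|].
  by left; apply: t_mul_kap.
have xy : x (y u v) v = x (x u v) v.
  by rewrite [x u v]x_kap // (bilDl (mulP OpX)) mul_z_kap ?addr0.
case: o; rewrite -?xy; [by right|by right; apply: y_mul_kap|by left; apply: z_mul_kap|].
by left; apply: t_mul_kap.
Qed.

Lemma kap_plus ta tb tc n : leaves ta + leaves tb + leaves tc = n.+3 -> (1 < n)%N ->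
  kap (ev ta) (ev tb) (ev tc) = 0 \/
  kap (ev ta) (ev tb) (ev tc) = iter n (fun a => x a v) (kap v v v).
Proof.
move=> def_n gt1; have [w sw ->] := kap_ev ta tb tc.
have <- : size w = n by lia.
by apply: foldl_kap; [exists v, v, v | lia].
Qed.

End KappaPlus.

(** * Algebras in which [kap] vanishes *)

(** A monomial whose dendriform image is the single tree [T], with mark [i]: a node with subtrees
    [l] and [r] is written as ([l] succ generator) prec [r], and at each step the operation is the
    variant that keeps the factor carrying the mark. Forgotten factors get the arbitrary mark 0. *)
Fixpoint ctree (T : bt) (i : nat) : tree :=
  if T is Bnode l r then
    let root := if l is Bnil then Leaf else Node OpY (ctree l 0) Leaf in
    let graft_r m := if r is Bnil then m else Node OpX m (ctree r 0) in
    if (i < nodes l)%N then graft_r (Node OpT (ctree l i) Leaf)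
    else if i == nodes l then graft_r root
    else Node OpZ root (ctree r (i - (nodes l).+1))
  else Leaf.

Section CanonicalTrees.

Let root (l : bt) := if l is Bnil then Leaf else Node OpY (ctree l 0) Leaf.
Let graft_r (r : bt) m := if r is Bnil then m else Node OpX m (ctree r 0).

Lemma ctree_left l r i : (i < nodes l)%N ->
  ctree (Bnode l r) i = graft_r r (Node OpT (ctree l i) Leaf).
Proof. by move=> /= ->. Qed.
Lemma ctree_mid l r : ctree (Bnode l r) (nodes l) = graft_r r (root l).
Proof. by rewrite /= ltnn eqxx. Qed.
Lemma ctree_right l r i :
  ctree (Bnode l r) ((nodes l).+1 + i) = Node OpZ (root l) (ctree r i).
Proof.
rewrite /= addKn; have -> : ((nodes l).+1 + i < nodes l)%N = false by lia.
by have -> : ((nodes l).+1 + i == nodes l)%N = false by lia.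
Qed.

Arguments ctree : simpl never.

Lemma ctreeP T i : (i < nodes T)%N ->
  dend (ctree T i) = [:: T] /\ mark (ctree T i) = i.
Proof.
elim: T i => [|l IHl r IHr] // i lt_i.
have rootP : dend (root l) = [:: Bnode l Bnil] /\ mark (root l) = nodes l.
  case: (l) IHl => // l1 l2 IHl; have [D M] := IHl 0%N isT.
  rewrite /= D /= addn0; split=> //.
  by rewrite -(nodes_dend (T := Bnode l1 l2)) ?D ?inE.
have graftP m j : dend m = [:: Bnode l Bnil] -> mark m = j ->
    dend (graft_r r m) = [:: Bnode l r] /\ mark (graft_r r m) = j.
  move=> Dm Mm; case: (r) IHr => // r1 r2 IHr; have [D M] := IHr 0%N isT.
  by rewrite /= D Dm.
have [lt_il|lt_li|->] := ltngtP i (nodes l).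
- have [D M] := IHl i lt_il; rewrite ctree_left //; apply: graftP => //=.
  by rewrite D /= /succ starT0.
- have def_i : i = ((nodes l).+1 + (i - (nodes l).+1))%N by lia.
  have lt_r : (i - (nodes l).+1 < nodes r)%N by move: lt_i => /=; lia.
  have [D M] := IHr _ lt_r; have [Dl Ml] := rootP.
  rewrite def_i ctree_right /= D Dl M; split=> //=.
  by rewrite -(nodes_dend (t := root l) (T := Bnode l Bnil)) ?Dl ?inE //= addn0.
by rewrite ctree_mid; apply: graftP; case: rootP.
Qed.

End CanonicalTrees.

Arguments ctree : simpl never.

(** * Canonical elements when [kap] vanishes *)

Section MarkedSpan.

Variables (k : fieldType) (eps : k) (A : lmodType k) (mul : binop -> A -> A -> A).
Hypotheses (mulP : forall o, bilinear2 (mul o)) (L : X_laws eps mul).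
Hypothesis eps2 : eps * eps = 1.
Hypothesis kap0 : forall a b c, kap mul a b c = 0.
Variable v : A.

Local Notation x := (mul OpX).
Local Notation y := (mul OpY).
Local Notation z := (mul OpZ).
Local Notation t := (mul OpT).

Let ev s := eval mul s (fun=> v) 0.
Let evN o l r : ev (Node o l r) = mul o (ev l) (ev r).
Proof. by rewrite /ev /= eval_const. Qed.

(* In the model, these are the pairs of elements that differ only by the      *)
(* position of their marks.                                                   *)
Definition sim a b := forall c,
  [/\ y a c = y b c, z a c = z b c, x c a = x c b & t c a = t c b].

Lemma sim_refl a : sim a a. Proof. by []. Qed.
Lemma sim_sym a b : sim a b -> sim b a.
Proof. by move=> ab c; have [-> -> -> ->] := ab c. Qed.
Lemma sim_trans a b c : sim a b -> sim b c -> sim a c.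
Proof. by move=> ab bc d; have [-> -> -> ->] := ab d; apply: bc. Qed.

Lemma sim_xz a b : sim (x a b) (z a b).
Proof.
move=> c; split; apply/eqP; rewrite -subr_eq0.
- by rewrite -(bilBl (mulP _)) -/(kap mul a b c) kap0.
- by rewrite -(bilBl (mulP _)) (z_dl mulP L).
- by rewrite -(bilBr (mulP _)) (x_dl mulP L eps2) kap0 scaler0.
- by rewrite -(bilBr (mulP _)) (t_dl mulP L).
Qed.

Lemma sim_ty a b : sim (t a b) (y a b).
Proof.
move=> c; split; apply/eqP; rewrite -subr_eq0.
- by rewrite -(bilBl (mulP _)) (y_ep mulP L) kap0 oppr0.
- by rewrite -(bilBl (mulP _)) (z_ep mulP L).
- by rewrite -(bilBr (mulP _)) (x_ep mulP L eps2) kap0 scaler0 oppr0.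
- by rewrite -(bilBr (mulP _)) (t_ep mulP L).
Qed.

(** Each operation forgets the mark of one factor, which can be replaced at once. Passing to its
    partner through [sim_xz] or [sim_ty] makes the other factor the forgotten one. *)
Lemma sim_mul o a a' b b' : sim a a' -> sim b b' -> sim (mul o a b) (mul o a' b').
Proof.
move=> aa' bb'; have [ya za _ _] := aa' b; have [_ _ xb tb] := bb' a'.
have simy : sim (y a b) (y a' b').
  rewrite ya; apply: sim_trans (sim_sym (sim_ty _ _)) _.
  by rewrite tb; apply: sim_ty.
have simz : sim (z a b) (z a' b').
  rewrite za; apply: sim_trans (sim_sym (sim_xz _ _)) _.
  by rewrite xb; apply: sim_xz.
case: o => //.
  exact: sim_trans (sim_xz _ _) (sim_trans simz (sim_sym (sim_xz _ _))).
exact: sim_trans (sim_ty _ _) (sim_trans simy (sim_sym (sim_ty _ _))).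
Qed.

Definition cval T i := ev (ctree T i).
(** [Ly l] is the generator with [l] attached on its left, [Rx r m] is [m] with [r] attached on its
    right; [Bnil] attaches nothing. *)
Let Ly l := if l is Bnil then v else y (cval l 0) v.
Let Rx r m := if r is Bnil then m else x m (cval r 0).

Let Rx_graft r m :
  ev (if r is Bnil then m else Node OpX m (ctree r 0)) = Rx r (ev m).
Proof. by case: r => //= *; rewrite evN. Qed.
Let Ly_root l : ev (if l is Bnil then Leaf else Node OpY (ctree l 0) Leaf) = Ly l.
Proof. by case: l => //= *; rewrite evN. Qed.

Let cval_left l r i : (i < nodes l)%N -> cval (Bnode l r) i = Rx r (t (cval l i) v).
Proof. by move=> lt_i; rewrite /cval ctree_left // Rx_graft evN. Qed.
Let cval_mid l r : cval (Bnode l r) (nodes l) = Rx r (Ly l).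
Proof. by rewrite /cval ctree_mid Rx_graft Ly_root. Qed.
Let cval_right l r i : cval (Bnode l r) ((nodes l).+1 + i) = z (Ly l) (cval r i).
Proof. by rewrite /cval ctree_right evN Ly_root. Qed.

Let LyE T : T != Bnil -> Ly T = y (cval T 0) v. Proof. by case: T. Qed.
Let RxE T m : T != Bnil -> Rx T m = x m (cval T 0). Proof. by case: T. Qed.

Let pos_neq0 T i : (i < nodes T)%N -> T != Bnil. Proof. by case: T. Qed.
Let neq0_pos T : T != Bnil -> (0 < nodes T)%N. Proof. by case: T. Qed.

Lemma sim_cval T i : (i < nodes T)%N -> sim (cval T i) (cval T 0).
Proof.
(* Every mark is compared with the mark at the root, the case of [cval_mid]. *)
suffices simC i' : (i' < nodes T)%N ->
    sim (cval T i') (if T is Bnode l r then Rx r (Ly l) else v).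
  move=> lt_i; apply: sim_trans (simC _ lt_i) (sim_sym (simC _ _)).
  exact: leq_ltn_trans lt_i.
elim: T i' => // l IHl r IHr {}i lt_i.
have sim_l j : (j < nodes l)%N -> sim (cval l j) (cval l 0).
  move=> lt_j; apply: sim_trans (IHl _ lt_j) (sim_sym (IHl _ _)).
  exact: leq_ltn_trans lt_j.
have sim_r j : (j < nodes r)%N -> sim (cval r j) (cval r 0).
  move=> lt_j; apply: sim_trans (IHr _ lt_j) (sim_sym (IHr _ _)).
  exact: leq_ltn_trans lt_j.
have simR m m' : sim m m' -> sim (Rx r m) (Rx r m').
  by case: (r) => // *; apply: sim_mul.
have [lt_il|lt_li|->] := ltngtP i (nodes l); last by rewrite cval_mid.
  rewrite cval_left //; apply: simR; rewrite (LyE (pos_neq0 lt_il)).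
  by apply: sim_trans (sim_ty _ _) (sim_mul _ (sim_l _ lt_il) (sim_refl _)).
have def_i : i = ((nodes l).+1 + (i - (nodes l).+1))%N by lia.
have lt_r : (i - (nodes l).+1 < nodes r)%N by move: lt_i => /=; lia.
rewrite def_i cval_right (RxE _ (pos_neq0 lt_r)).
apply: sim_trans (sim_sym (sim_xz _ _)) (sim_mul _ (sim_refl _) (sim_r _ lt_r)).
Qed.

Let prodP T T' := forall i j, (i < nodes T)%N -> (j < nodes T')%N ->
  [/\ x (cval T i) (cval T' j) = \sum_(u <- prec T T') cval u i,
      z (cval T i) (cval T' j) = \sum_(u <- prec T T') cval u (nodes T + j),
      t (cval T i) (cval T' j) = \sum_(u <- succ T T') cval u i
    & y (cval T i) (cval T' j) = \sum_(u <- succ T T') cval u (nodes T + j)].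

Let xt_star T T' i j : prodP T T' -> (i < nodes T)%N -> (j < nodes T')%N ->
  x (cval T i) (cval T' j) + t (cval T i) (cval T' j) = \sum_(u <- star T T') cval u i.
Proof.
move=> P lt_i lt_j; have [-> _ -> _] := P _ _ lt_i lt_j.
by rewrite -sum_star // ?(pos_neq0 lt_i) ?(pos_neq0 lt_j).
Qed.

Let zy_star T T' i j : prodP T T' -> (i < nodes T)%N -> (j < nodes T')%N ->
  z (cval T i) (cval T' j) + y (cval T i) (cval T' j) =
    \sum_(u <- star T T') cval u (nodes T + j).
Proof.
move=> P lt_i lt_j; have [_ -> _ ->] := P _ _ lt_i lt_j.
by rewrite -sum_star // ?(pos_neq0 lt_i) ?(pos_neq0 lt_j).
Qed.

Let x_Rx r m T j : (r != Bnil -> prodP r T) -> (j < nodes T)%N ->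
  x (Rx r m) (cval T j) = \sum_(u <- star r T) Rx u m.
Proof.
move=> P lt_j; have nT := pos_neq0 lt_j.
have [r0|nr] := eqVneq r Bnil.
  rewrite r0 star0T big_seq1 (RxE _ nT).
  by have [_ _ -> _] := sim_cval lt_j m.
rewrite (RxE _ nr) (lawxx L) -(bilDr (mulP _)) (xt_star (P nr)) ?neq0_pos //.
rewrite (bil_sumr (mulP _)); apply: eq_big_seq => u su; rewrite RxE //.
by apply: star_neq0 su; rewrite nr.
Qed.

Let z_Rx r m T j : (r != Bnil -> prodP r T) -> (j < nodes T)%N ->
  z (Rx r m) (cval T j) = \sum_(u <- star r T) z m (cval u (nodes r + j)).
Proof.
move=> P lt_j; have [r0|nr] := eqVneq r Bnil; first by rewrite r0 star0T big_seq1.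
rewrite (RxE _ nr) (lawzx L) -(bilDr (mulP _)) (zy_star (P nr)) ?neq0_pos //.
by rewrite (bil_sumr (mulP _)).
Qed.

Let t_Rx r m c : t c (Rx r m) = Rx r (t c m).
Proof. by case: r => //= *; rewrite (lawxt L). Qed.
Let y_Rx r m c : y c (Rx r m) = Rx r (y c m).
Proof. by case: r => //= *; rewrite (lawxy L). Qed.
Let Rx_sum r (s : seq bt) F : Rx r (\sum_(u <- s) F u) = \sum_(u <- s) Rx r (F u).
Proof. by case: r => //= *; rewrite (bil_suml (mulP _)). Qed.

Let t_Ly T l i : (l != Bnil -> prodP T l) -> (i < nodes T)%N ->
  t (cval T i) (Ly l) = \sum_(u <- star T l) t (cval u i) v.
Proof.
move=> P lt_i; have [->|nl] := eqVneq l Bnil; first by rewrite starT0 big_seq1.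
rewrite (LyE nl) -(lawtt' L) -(bilDl (mulP _)) (xt_star (P nl)) ?neq0_pos //.
by rewrite (bil_suml (mulP _)).
Qed.

Let y_Ly T l i : (l != Bnil -> prodP T l) -> (i < nodes T)%N ->
  y (cval T i) (Ly l) = \sum_(u <- star T l) Ly u.
Proof.
move=> P lt_i; have nT := pos_neq0 lt_i.
have [->|nl] := eqVneq l Bnil.
  rewrite starT0 big_seq1 (LyE nT).
  by have [-> _ _ _] := sim_cval lt_i v.
rewrite (LyE nl) -(lawyz L) -(bilDl (mulP _)) (zy_star (P nl)) ?neq0_pos //.
rewrite (bil_suml (mulP _)); apply: eq_big_seq => u su.
have nu : u != Bnil by apply: star_neq0 su; rewrite nl orbT.
rewrite (LyE nu); have [|-> _ _ _ //] := @sim_cval u (nodes T + 0) _ v.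
by rewrite (nodes_star su) ltn_add2l neq0_pos.
Qed.

(** Canonical elements multiply as in the model. As in the definitions of [prec] and [succ], [x] and
    [z] open the root of [T], [t] and [y] that of [T']; a law moves the other factor into a subtree,
    where induction on the total number of nodes applies. [sim_cval] corrects the marks in forgotten
    factors. *)
Lemma mul_cval T T' : prodP T T'.
Proof.
have [n] := ubnP (nodes T + nodes T').
elim: n T T' => // n IHn T T' lt_n.
have IH T1 T1' : (nodes T1 + nodes T1' < nodes T + nodes T')%N -> prodP T1 T1'.
  by move=> lt_T1; apply: IHn; lia.
move=> {n IHn lt_n} i j lt_i lt_j; split.
- case: T => [|l r] // in lt_i IH *; rewrite sum_prec.
  have P : r != Bnil -> prodP r T' by move=> _; apply: IH => /=; lia.
  have [lt_il|lt_li|->] := ltngtP i (nodes l).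
  + by rewrite cval_left // x_Rx //; apply: eq_bigr => u _; rewrite cval_left.
  + have -> : i = ((nodes l).+1 + (i - (nodes l).+1))%N by lia.
    have lt_r : (i - (nodes l).+1 < nodes r)%N by move: lt_i => /=; lia.
    rewrite cval_right (lawxz L) -(bilDr (mulP _)) xt_star ?(bil_sumr (mulP _)) //.
      by apply: eq_bigr => u _; rewrite cval_right.
    exact: P (pos_neq0 lt_r).
  by rewrite cval_mid x_Rx //; apply: eq_bigr => u _; rewrite cval_mid.
- case: T => [|l r] // in lt_i IH *; rewrite sum_prec.
  have P : r != Bnil -> prodP r T' by move=> _; apply: IH => /=; lia.
  have -> : (nodes (Bnode l r) + j = (nodes l).+1 + (nodes r + j))%N by rewrite /= addnA.
  under eq_bigr => u _ do rewrite cval_right.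
  have [lt_il|lt_li|->] := ltngtP i (nodes l).
  + rewrite cval_left // z_Rx //; apply: eq_bigr => u _.
    rewrite (LyE (pos_neq0 lt_il)).
    have simL : sim (t (cval l i) v) (y (cval l 0) v).
      exact: sim_trans (sim_ty _ _) (sim_mul OpY (sim_cval lt_il) (sim_refl v)).
    by have [_ -> _ _] := simL (cval u (nodes r + j)).
  + have -> : i = ((nodes l).+1 + (i - (nodes l).+1))%N by lia.
    have lt_r : (i - (nodes l).+1 < nodes r)%N by move: lt_i => /=; lia.
    rewrite cval_right (lawzz L) -(bilDr (mulP _)) zy_star ?(bil_sumr (mulP _)) //.
    exact: P (pos_neq0 lt_r).
  by rewrite cval_mid z_Rx.
- case: T' => [|l r] // in lt_j IH *; rewrite sum_succ.
  have P : l != Bnil -> prodP T l by move=> _; apply: IH => /=; lia.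
  have lt_u u : u \in star T l -> (i < nodes u)%N by move=> /nodes_star->; lia.
  rewrite (eq_big_seq _ (fun u su => cval_left r (lt_u u su))) -Rx_sum.
  have [lt_jl|lt_lj|->] := ltngtP j (nodes l).
  + rewrite cval_left // t_Rx; congr Rx.
    rewrite -(lawtt L) -(bilDl (mulP _)) xt_star ?(bil_suml (mulP _)) //.
    exact: P (pos_neq0 lt_jl).
  + have -> : j = ((nodes l).+1 + (j - (nodes l).+1))%N by lia.
    have lt_r : (j - (nodes l).+1 < nodes r)%N by move: lt_j => /=; lia.
    rewrite cval_right -(lawxt' L) -t_Ly // (RxE _ (pos_neq0 lt_r)).
    by have [_ _ -> _] := sim_cval lt_r (t (cval T i) (Ly l)).
  by rewrite cval_mid t_Rx t_Ly.
case: T' => [|l r] // in lt_j IH *; rewrite sum_succ.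
have P : l != Bnil -> prodP T l by move=> _; apply: IH => /=; lia.
have [lt_jl|lt_lj|->] := ltngtP j (nodes l).
- have lt_u u : u \in star T l -> (nodes T + j < nodes u)%N by move=> /nodes_star->; lia.
  rewrite (eq_big_seq _ (fun u su => cval_left r (lt_u u su))) -Rx_sum.
  rewrite cval_left // y_Rx; congr Rx.
  rewrite -(lawtz L) -(bilDl (mulP _)) zy_star ?(bil_suml (mulP _)) //.
  exact: P (pos_neq0 lt_jl).
- have -> : j = ((nodes l).+1 + (j - (nodes l).+1))%N by lia.
  have lt_r : (j - (nodes l).+1 < nodes r)%N by move: lt_j => /=; lia.
  rewrite cval_right -(lawzy L) y_Ly // (bil_suml (mulP _)); apply: eq_big_seq => u su.
  rewrite -cval_right; congr cval; rewrite (nodes_star su); lia.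
rewrite cval_mid y_Rx y_Ly // Rx_sum; apply: eq_big_seq => u su.
by rewrite -(nodes_star su) cval_mid.
Qed.

Lemma ev_dend s : ev s = \sum_(T <- dend s) cval T (mark s).
Proof.
elim: s => [|o l IHl r IHr]; first by rewrite big_seq1.
rewrite evN IHl IHr (bil_suml (mulP o)) sum_dend_node; apply: eq_big_seq => T sT.
rewrite (bil_sumr (mulP o)); apply: eq_big_seq => T' sT'.
have [||X Z' T0 Y] := @mul_cval T T' (mark l) (mark r).
- by rewrite (nodes_dend sT) lt_mark.
- by rewrite (nodes_dend sT') lt_mark.
by case: o => /=; rewrite -?(nodes_dend sT).
Qed.

End MarkedSpan.

(** * Quotients of the free algebra *)

Section Monomials.

Variable k : fieldType.

(** Total variant of [monomial], equal to 0 if the arity of [w] is not [n]; it avoids casts between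
    arities. *)
Definition mon n (w : tree) : freeop k n := [ffun u => (ntval u == w)%:R].

Lemma mon0 n w : leaves w != n -> mon n w = 0.
Proof.
move=> ne_n; apply/ffunP=> u; rewrite !ffunE; case: eqP => // def_w.
by case/negP: ne_n; rewrite -def_w (valP u).
Qed.

Lemma monE n (u : ntree n) : mon n u = monomial k u.
Proof. by apply/ffunP=> u'; rewrite !ffunE. Qed.

Lemma ext_mon (V : lmodType k) (phi : tree -> V) n w :
  ext phi (mon n w) = if leaves w == n then phi w else 0.
Proof.
case: ifPn => [wP|/mon0->]; last exact: linear0.
by rewrite -(ext_monomial phi (NTree wP)) -monE.
Qed.

Lemma ext_id n (f : freeop k n) : ext (mon n) f = f.
Proof.
apply/ffunP=> u; rewrite sum_ffunE (bigD1 u) //= !ffunE eqxx [_ *: _]mulr1.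
rewrite big1 ?addr0 // => u' ne_u; rewrite !ffunE.
case: eqP => [eq_u|_]; last by rewrite scaler0.
by case/eqP: ne_u; apply: val_inj.
Qed.

Lemma ext_sum (V : lmodType k) (phi : tree -> V) n I (r : seq I) (c : I -> k) F :
  ext phi (\sum_(i <- r) c i *: F i : freeop k n) =
    \sum_(i <- r) c i *: ext phi (F i).
Proof. by rewrite linear_sum; apply: eq_bigr => i _; rewrite linearZ. Qed.

Lemma eq_ext (V : lmodType k) (phi psi : tree -> V) n (f : freeop k n) :
  (forall t : ntree n, phi t = psi t) -> ext phi f = ext psi f.
Proof. by move=> eq_phi; apply: eq_bigr => t _; rewrite eq_phi. Qed.

Lemma ext_comp (V W : lmodType k) (phi : tree -> V) (L : {linear V -> W}) n
    (f : freeop k n) : L (ext phi f) = ext (fun t => L (phi t)) f.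
Proof. by rewrite linear_sum; apply: eq_bigr => t _; rewrite linearZ. Qed.

Lemma ext_ext_mon (V : lmodType k) (phi : tree -> V) (psi : tree -> tree) m n
    (f : freeop k n) : (forall t : ntree n, leaves (psi t) = m) ->
  ext phi (ext (fun t => mon m (psi t)) f) = ext (fun t => phi (psi t)) f.
Proof.
by move=> psiP; rewrite ext_comp; apply: eq_ext => t /=; rewrite ext_mon psiP eqxx.
Qed.

Lemma ext_opcomp_mon (V : lmodType k) (phi : tree -> V) m (f : freeop k m) i s :
    (i < m)%N ->
  ext phi (opcomp f i (mon (leaves s) s)) = ext (fun u => phi (graft u i s)) f.
Proof.
move=> lt_i; rewrite ext_opcomp //; apply: eq_bigr => u _.
under eq_bigr => t _ do rewrite -scalerA.
rewrite -scaler_sumr; congr (_ *: _).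
by rewrite -[LHS]/(ext (graft u i \; phi) _) ext_mon eqxx.
Qed.

Lemma opcomp_mon_ext n (f : freeop k n) s i : (i < leaves s)%N ->
  opcomp (mon (leaves s) s) i f =
    ext (fun t => mon (leaves s + n).-1 (graft s i t)) f.
Proof.
move=> lt_i; rewrite -[LHS]ext_id ext_opcomp //.
rewrite exchange_big; apply: eq_bigr => t _ /=.
under eq_bigr => u _ do rewrite mulrC -scalerA.
rewrite -scaler_sumr; congr (_ *: _).
by rewrite -[LHS]/(ext (fun u => mon _ (graft u i t)) _) ext_mon eqxx.
Qed.

End Monomials.

(** * The truncated free algebra on one generator, modulo an ideal *)

Section FreeQuotient.

Variables (k : fieldType) (N : nat) (J : forall n, {vspace freeop k n}).

(* [J] is a graded ideal of the free algebra on one generator. *)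
Definition tree_ideal : Prop :=
  (forall o n m s (f : freeop k n), m = (n + leaves s)%N ->
     f \in J n -> ext (fun t => mon k m (Node o t s)) f \in J m) /\
  (forall o n m s (f : freeop k n), m = (leaves s + n)%N ->
     f \in J n -> ext (fun t => mon k m (Node o s t)) f \in J m).

Hypothesis JI : tree_ideal.

Definition tree_terms : seq tree := [seq t <- trees_upto N | (leaves t <= N)%N].

Lemma mem_tree_terms t : (t \in tree_terms) = (leaves t <= N)%N.
Proof. by rewrite mem_filter; case: leqP => // /mem_trees_upto->. Qed.

Local Notation S := (trunc k tree_terms).
Local Notation e := (tr_basis k tree_terms).

Definition mulS o : S -> S -> S := tr_mul (fun l r => [:: Node o l r]).

Lemma mulS_bilinear o : bilinear2 (mulS o). Proof. exact: tr_mul_bilinear. Qed.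

Let e0 t : (N < leaves t)%N -> e t = 0.
Proof. by move=> gt_N; apply: tr_basis0; rewrite mem_tree_terms -ltnNge. Qed.

Lemma mulS_basis o l r : mulS o (e l) (e r) = e (Node o l r).
Proof.
have [le_l|lt_l] := leqP (leaves l) N; last first.
  by rewrite (e0 lt_l) (bil0l (mulS_bilinear o)) e0 //= ltn_addr.
have [le_r|lt_r] := leqP (leaves r) N; last first.
  by rewrite (e0 lt_r) (bil0r (mulS_bilinear o)) e0 //= ltn_addl.
by rewrite /mulS tr_mul_basis ?mem_tree_terms ?big_seq1.
Qed.

Definition homog n (f : S) : freeop k n := \sum_i f i *: mon k n (ssval i).

Lemma homog_is_linear n : linear (homog n).
Proof.
move=> c f g; rewrite /homog scaler_sumr -big_split; apply: eq_bigr => i _ /=.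
by rewrite !ffunE scalerDl scalerA.
Qed.
HB.instance Definition _ n := GRing.isLinear.Build k S (freeop k n) _ (homog n)
  (homog_is_linear n).

Lemma homog_basis n t : (n <= N)%N -> homog n (e t) = mon k n t.
Proof.
move=> le_n; have [le_t|gt_t] := leqP (leaves t) N; last first.
  by rewrite e0 // linear0 mon0 //; lia.
have st : t \in tree_terms by rewrite mem_tree_terms.
rewrite /homog (bigD1 (SeqSub st)) //= ffunE eqxx scale1r big1 ?addr0 //.
move=> i ne_i; rewrite ffunE; case: eqP => [eq_t|_]; last by rewrite scale0r.
by case/eqP: ne_i; apply: val_inj.
Qed.

Let inU (f : S) : Prop := forall n, (n <= N)%N -> homog n f \in J n.

Fact ideal_space_ex : exists U : {vspace S}, forall f, f \in U <-> inU f.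
Proof.
apply: vspace_of_submod => [n _|c f g fU gU n le_n].
  by rewrite linear0 mem0v.
by rewrite linearP memvD ?memvZ ?fU ?gU.
Qed.
Definition ideal_space : {vspace S} := projT1 (cid ideal_space_ex).
Local Notation U := ideal_space.
Let UP f : f \in U <-> inU f. Proof. exact: projT2 (cid ideal_space_ex) f. Qed.

Let mulS_Ul o f g : f \in U -> mulS o f g \in U.
Proof.
move=> /UP fU; rewrite [g]tr_expand (bil_sumr (mulS_bilinear o)).
apply: memv_suml => j _; rewrite (bilZr (mulS_bilinear o)) memvZ //.
apply/UP => m le_m; set s := ssval j.
rewrite [f]tr_expand (bil_suml (mulS_bilinear o)).
under eq_bigr => i _ do rewrite (bilZl (mulS_bilinear o)) mulS_basis.
rewrite linear_sum; under eq_bigr => i _ do rewrite linearZ /= homog_basis //.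
have [lt_m|le_s] := ltnP m (leaves s).
  rewrite big1 ?mem0v // => i _; rewrite mon0 ?scaler0 //=; lia.
have def_m : m = (m - leaves s + leaves s)%N by rewrite subnK.
suffices -> : \sum_i f i *: mon k m (Node o (ssval i) s) =
    ext (fun t => mon k m (Node o t s)) (homog (m - leaves s) f).
  by apply: JI.1 => //; apply: fU; apply: leq_trans le_m; apply: leq_subr.
rewrite ext_sum; apply: eq_bigr => i _; rewrite ext_mon.
by case: ifP => // /negbT ne; rewrite mon0 //=; lia.
Qed.

Let mulS_Ur o f g : g \in U -> mulS o f g \in U.
Proof.
move=> /UP gU; rewrite [f]tr_expand (bil_suml (mulS_bilinear o)).
apply: memv_suml => j _; rewrite (bilZl (mulS_bilinear o)) memvZ //.
apply/UP => m le_m; set s := ssval j.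
rewrite [g]tr_expand (bil_sumr (mulS_bilinear o)).
under eq_bigr => i _ do rewrite (bilZr (mulS_bilinear o)) mulS_basis.
rewrite linear_sum; under eq_bigr => i _ do rewrite linearZ /= homog_basis //.
have [lt_m|le_s] := ltnP m (leaves s).
  rewrite big1 ?mem0v // => i _; rewrite mon0 ?scaler0 //=; lia.
have def_m : m = (leaves s + (m - leaves s))%N by rewrite subnKC.
suffices -> : \sum_i g i *: mon k m (Node o s (ssval i)) =
    ext (fun t => mon k m (Node o s t)) (homog (m - leaves s) g).
  by apply: JI.2 => //; apply: gU; apply: leq_trans le_m; apply: leq_subr.
rewrite ext_sum; apply: eq_bigr => i _; rewrite ext_mon.
by case: ifP => // /negbT ne; rewrite mon0 //=; lia.
Qed.

Definition free_quot := vquot U.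
HB.instance Definition _ := Vector.on free_quot.
Local Notation pi := (@vquot_pi k S U).

Definition mulQ o (p q : free_quot) : free_quot := pi (mulS o (repr p) (repr q)).

Lemma mulQ_pi o f g : mulQ o (pi f) (pi g) = pi (mulS o f g).
Proof.
have reprB h : repr (pi h) - h \in U by rewrite -vquot_pi_eq vquot_reprK.
apply/eqP; rewrite vquot_pi_eq -[mulS o (repr _) _](subrK (mulS o f (repr (pi g)))).
rewrite -addrA -(bilBl (mulS_bilinear o)) -(bilBr (mulS_bilinear o)).
by apply: memvD; [apply: mulS_Ul | apply: mulS_Ur].
Qed.

Lemma mulQ_bilinear o : bilinear2 (mulQ o).
Proof.
have [Sl Sr] := mulS_bilinear o.
split=> c p p' q; rewrite -[p]vquot_reprK -[p']vquot_reprK -[q]vquot_reprK.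
  by rewrite -linearP !mulQ_pi Sl linearP.
by rewrite -linearP !mulQ_pi Sr linearP.
Qed.

Definition genQ : free_quot := pi (e Leaf).
Definition evQ (t : tree) : free_quot := eval mulQ t (fun=> genQ) 0.

Lemma evQ_pi t : evQ t = pi (e t).
Proof.
rewrite /evQ; elim: t => //= o l IHl r IHr.
by rewrite eval_const IHl IHr mulQ_pi mulS_basis.
Qed.

(** The bridge between operads and algebras: without symmetric group actions, an operation is
    recovered from its value at copies of one free generator. *)
Lemma ext_evQ_eq0 n (f : freeop k n) : (n <= N)%N -> (ext evQ f == 0) = (f \in J n).
Proof.
move=> le_n.
have -> : ext evQ f = pi (ext e f).
  by rewrite [RHS]ext_comp; apply: eq_ext => t; rewrite evQ_pi.
rewrite -[0](linear0 pi) vquot_pi_eq subr0.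
have homogE m : (m <= N)%N -> homog m (ext e f) = ext (mon k m) f.
  by move=> le_m; rewrite ext_comp; apply: eq_ext => t; rewrite /= homog_basis.
apply/idP/idP => [/UP/(_ n le_n)|fJ]; first by rewrite homogE // ext_id.
apply/UP => m le_m; rewrite homogE //.
have [eq_mn|ne_mn] := eqVneq m n; first by rewrite eq_mn ext_id.
rewrite [ext _ _]big1 ?mem0v // => t _; rewrite mon0 ?scaler0 //.
by rewrite (eqP (valP t)) eq_sym.
Qed.

Lemma ext_evQ0 n (f : freeop k n) : f \in J n -> ext evQ f = 0.
Proof.
have [le_n fJ|gt_n _] := leqP n N; first by apply/eqP; rewrite ext_evQ_eq0.
rewrite [LHS]big1 // => t _; rewrite evQ_pi e0 ?linear0 ?scaler0 //.
by rewrite (eqP (valP t)).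
Qed.

(** By multilinearity, a ternary identity may be tested on monomials, one argument at a time.
    Grafting at 2, then 1, then 0 keeps the numbers of the remaining leaves valid. *)
Lemma ext3_eq0 (g : freeop k 3) :
    (forall s0 s1 s2, ext (fun u => mon k (leaves s0 + leaves s1 + leaves s2)
         (graft (graft (graft u 2 s2) 1 s1) 0 s0)) g
       \in J (leaves s0 + leaves s1 + leaves s2)) ->
  forall a, ext (fun u => eval mulQ u a 0) g = 0.
Proof.
move=> gJ; pose upd a j p h : free_quot := if h == j :> nat then p else a h.
have lin j (a : nat -> free_quot) : (j < 3)%N ->
    (forall s, ext (fun u => eval mulQ u (upd a j (evQ s)) 0) g = 0) ->
  ext (fun u => eval mulQ u a 0) g = 0.
  move=> lt_j a0; have [f def_f] : exists f, a j = pi f.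
    by exists (repr (a j)); rewrite vquot_reprK.
  have def_aj : a j = \sum_i f i *: evQ (ssval i).
    rewrite def_f [f in LHS]tr_expand linear_sum; apply: eq_bigr => i _.
    by rewrite linearZ evQ_pi.
  transitivity (ext (fun u => \sum_i f i *: eval mulQ u (upd a j (evQ (ssval i))) 0) g).
    apply: eq_ext => u; rewrite -(eval_sum mulQ_bilinear); last by rewrite (eqP (valP u)).
    by apply: eval_local => h _; case: eqP => // ->.
  rewrite /ext; under eq_bigr => u _ do rewrite scaler_sumr.
  rewrite exchange_big big1 // => i _.
  under eq_bigr => u _ do rewrite scalerA mulrC -scalerA.
  by rewrite -scaler_sumr; apply: etrans (scaler0 _ (f i)); congr (_ *: _); apply: a0.
move=> a; apply: (lin 0%N) => // s0; apply: (lin 1%N) => // s1; apply: (lin 2%N) => // s2.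
rewrite -[RHS](ext_evQ0 (gJ s0 s1 s2)) [RHS]ext_comp; apply: eq_ext => u /=.
have lu : leaves u = 3 := eqP (valP u).
have l2 : leaves (graft u 2 s2) = (2 + leaves s2)%N by rewrite leaves_graft lu.
have [[p0 p1] p2] := (leaves_gt0 s0, leaves_gt0 s1, leaves_gt0 s2).
have l1 : leaves (graft (graft u 2 s2) 1 s1) = (1 + leaves s1 + leaves s2)%N.
  by rewrite leaves_graft l2; lia.
rewrite ext_mon leaves_graft l1; last by lia.
rewrite ifT /evQ; last by apply/eqP; lia.
rewrite eval_graft ?l1 // eval_graft ?l2 // eval_graft ?lu //.
apply: eval_local; rewrite lu => -[|[|[|j]]] // _.
  rewrite /upd /= -(eval_const _ _ _ (0 + 1)%N); apply: eval_local => h lt_h /=.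
  by case: h lt_h.
rewrite /upd /= -(eval_const _ _ _ (0 + 2)%N); apply: eval_local => h lt_h /=.
by case: h lt_h => [|[|h]].
Qed.

End FreeQuotient.

(** * Dimensions *)

Section Presentation.

Variables (k : fieldType) (eps : k).

Lemma X_ideal_graft_r n (f : freeop k n) s i : (i < leaves s)%N ->
    f \in X_ideal eps n ->
  ext (fun t => mon k (leaves s + n).-1 (graft s i t)) f \in X_ideal eps (leaves s + n).-1.
Proof.
move=> lt_i fI; rewrite -opcomp_mon_ext //.
exact: ideal_compr (operadic_ideal_generated _) _ _ _ _ _ lt_i fI.
Qed.

Lemma X_ideal_graft_l m (f : freeop k m) s i : (i < m)%N ->
    f \in X_ideal eps m ->
  ext (fun u => mon k (m + leaves s).-1 (graft u i s)) f \in X_ideal eps (m + leaves s).-1.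
Proof.
move=> lt_i fI; rewrite -(ext_opcomp_mon (mon k _)) // ext_id.
exact: ideal_compl (operadic_ideal_generated _) _ _ _ _ _ lt_i fI.
Qed.

Lemma X_ideal_tree_ideal : tree_ideal (X_ideal eps).
Proof.
split=> o n m s f def_m fI.
  have -> : m = (leaves (Node o Leaf s) + n).-1 by rewrite /=; lia.
  exact: (X_ideal_graft_r (s := Node o Leaf s) (i := 0)).
have -> : m = (leaves (Node o s Leaf) + n).-1 by rewrite /=; lia.
have lt_s : (leaves s < leaves (Node o s Leaf))%N by rewrite /= addn1.
by have := X_ideal_graft_r lt_s fI; rewrite /= ltnn.
Qed.

(** Applied both to [X_ideal], to compute composites of [kap], and to [kap_ideal], where [kap] is
    0. *)
Lemma X_quot_laws N (J : forall n, {vspace freeop k n}) (JI : tree_ideal J) :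
  (forall n, X_ideal eps n <= J n)%VS -> X_laws eps (@mulQ k N J).
Proof.
move=> XJ; apply: X_algebra_laws; split=> [o|r a rX]; first exact: mulQ_bilinear.
apply/eqP; rewrite -subr_eq0 -extB; apply/eqP/ext3_eq0 => // s0 s1 s2.
have gI : r.1 - r.2 \in X_ideal eps 3.
  by apply: mem_generated_ideal; apply/mapP; exists r.
have [[p0 p1] p2] := (leaves_gt0 s0, leaves_gt0 s1, leaves_gt0 s2).
have /(X_ideal_graft_l s1 (i := 1)) := X_ideal_graft_l s2 (isT : 2 < 3)%N gI.
move=> /(_ _)/(X_ideal_graft_l s0 (i := 0)).
have -> : (((3 + leaves s2).-1 + leaves s1).-1 + leaves s0).-1 =
  (leaves s0 + leaves s1 + leaves s2)%N by lia.
set n := (_ + _ + _)%N => gI3; apply: (subvP (XJ _)).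
have lu (u : ntree 3) : leaves u = 3 := eqP (valP u).
have l2 (u : ntree 3) : leaves (graft u 2 s2) = (3 + leaves s2).-1.
  by rewrite leaves_graft lu.
have l1 (u : ntree 3) :
    leaves (graft (graft u 2 s2) 1 s1) = ((3 + leaves s2).-1 + leaves s1).-1.
  by rewrite leaves_graft l2 //; lia.
rewrite (ext_ext_mon (fun t => mon k _ (graft t 1 s1))
  (psi := fun t => graft t 2 s2) _ l2) in gI3.
rewrite (ext_ext_mon (fun t => mon k n (graft t 0 s0))
  (psi := fun t => graft (graft t 2 s2) 1 s1) _ l1) in gI3.
by apply: gI3; lia.
Qed.

Definition kmon n (a b c : tree) : freeop k n :=
  mon k n (Node OpY (Node OpX a b) c) - mon k n (Node OpY (Node OpZ a b) c).

(** The enumeration also contains trees with the wrong number of leaves; these contribute 0 by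
    [kmon0]. *)
Definition kap_space n : {vspace freeop k n} :=
  <<[seq kmon n p.1.1 p.1.2 p.2 | p <- [seq (q, c) | q <-
      [seq (a, b) | a <- trees_upto n, b <- trees_upto n], c <- trees_upto n]]>>%VS.

Definition kap_ideal n : {vspace freeop k n} := (X_ideal eps n + kap_space n)%VS.

Lemma kmon0 n a b c : (leaves a + leaves b + leaves c)%N != n -> kmon n a b c = 0.
Proof. by move=> ne_n; rewrite /kmon !mon0 ?subr0. Qed.

Lemma kap_spaceP n (V : {vspace freeop k n}) :
    (forall a b c, (leaves a + leaves b + leaves c)%N = n -> kmon n a b c \in V) ->
  (kap_space n <= V)%VS.
Proof.
move=> kV; apply/span_subvP => _ /mapP[[[a b] c] _ ->] /=.
have [|ne_n] := eqVneq (leaves a + leaves b + leaves c)%N n; first exact: kV.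
by rewrite kmon0 ?mem0v.
Qed.

Lemma mem_kap_space n a b c : kmon n a b c \in kap_space n.
Proof.
have [def_n|ne_n] := eqVneq (leaves a + leaves b + leaves c)%N n; last first.
  by rewrite kmon0 ?mem0v.
have mem_t t : (leaves t <= n)%N -> t \in trees_upto n by apply: mem_trees_upto.
apply: memv_span; apply/mapP; exists ((a, b), c) => //.
apply/allpairsP; exists ((a, b), c); split => //=; last by apply: mem_t; lia.
by apply/allpairsP; exists (a, b); split => //=; apply: mem_t; lia.
Qed.

Lemma X_kap_ideal n : (X_ideal eps n <= kap_ideal n)%VS.
Proof. exact: addvSl. Qed.

Lemma ext_kmon (V : lmodType k) (phi : tree -> V) n a b c :
    (leaves a + leaves b + leaves c)%N = n ->
  ext phi (kmon n a b c) =
    phi (Node OpY (Node OpX a b) c) - phi (Node OpY (Node OpZ a b) c).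
Proof. by move=> def_n; rewrite extB; congr (_ - _); rewrite ext_mon /= def_n eqxx. Qed.

Let mulX_bil N o : bilinear2 (@mulQ k N (X_ideal eps) o).
Proof. exact: mulQ_bilinear X_ideal_tree_ideal o. Qed.
Let mulX_laws N : X_laws eps (@mulQ k N (X_ideal eps)).
Proof. exact: X_quot_laws X_ideal_tree_ideal _. Qed.

Section Quotient.

Variable N : nat.
Local Notation mulX := (@mulQ k N (X_ideal eps)).
Local Notation evX := (@evQ k N (X_ideal eps)).

Lemma evX_node o l r : evX (Node o l r) = mulX o (evX l) (evX r).
Proof. by rewrite /evQ /= eval_const. Qed.

Lemma ext_evX_kmon n a b c : (leaves a + leaves b + leaves c)%N = n ->
  ext evX (kmon n a b c) = kap mulX (evX a) (evX b) (evX c).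
Proof.
move=> def_n; rewrite ext_kmon // !evX_node -(bilBl (mulX_bil N OpY)).
by rewrite /kap /dl.
Qed.

End Quotient.

Lemma kmon_mul_l o m a b c s : (leaves a + leaves b + leaves c + leaves s)%N = m ->
  mon k m (Node o (Node OpY (Node OpX a b) c) s) -
  mon k m (Node o (Node OpY (Node OpZ a b) c) s) - kmon m a b (Node o c s)
    \in X_ideal eps m.
Proof.
move=> def_m; rewrite -(ext_evQ_eq0 X_ideal_tree_ideal _ (leqnn m)).
rewrite extB ext_evX_kmon /= ?addnA // extB.
rewrite [X in X - _ - _]ext_mon [X in _ - X - _]ext_mon /= def_m eqxx.
rewrite !evX_node -!(bilBl (mulX_bil m _)) -/(dl _ _ _) -/(kap _ _ _ _).
by rewrite (mul_kap_l (mulX_bil m) (mulX_laws m)) subrr.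
Qed.

Lemma kmon_mul_r o m a b c s : (leaves s + leaves a + leaves b + leaves c)%N = m ->
  mon k m (Node o s (Node OpY (Node OpX a b) c)) -
  mon k m (Node o s (Node OpY (Node OpZ a b) c)) - kmon m (Node o s a) b c
    \in X_ideal eps m.
Proof.
move=> def_m; rewrite -(ext_evQ_eq0 X_ideal_tree_ideal _ (leqnn m)).
rewrite extB ext_evX_kmon //= extB.
rewrite [X in X - _ - _]ext_mon [X in _ - X - _]ext_mon /= !addnA def_m eqxx.
rewrite !evX_node -(bilBr (mulX_bil m o)) -!(bilBl (mulX_bil m _)).
rewrite -/(dl _ _ _) -/(kap _ _ _ _).
by rewrite (mul_kap_r (mulX_bil m) (mulX_laws m)) subrr.
Qed.

(** No closure is taken in [kap_ideal]: by [mul_kap_l] and [mul_kap_r], the values of [kap] are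
    already stable under products modulo the relations. *)
Lemma kap_tree_ideal : tree_ideal kap_ideal.
Proof.
have [XIl XIr] := X_ideal_tree_ideal.
split=> o n m s f def_m /memv_addP[g gX [h hK ->]]; rewrite linearD /= memvD //.
- by rewrite (subvP (X_kap_ideal m)) ?XIl.
- pose phi t := mon k m (Node o t s).
  suffices /subvP/(_ h hK) : (kap_space n <= linfun (ext phi (n := n)) @^-1: kap_ideal m)%VS.
    by rewrite -memv_preim lfunE.
  apply: kap_spaceP => a b c def_n; rewrite -memv_preim lfunE /= ext_kmon // /phi.
  rewrite -[X in X \in _](subrK (kmon m a b (Node o c s))).
  apply: memvD; last exact: subvP (addvSr _ _) _ (mem_kap_space _ _ _ _).
  by apply: (subvP (X_kap_ideal m)); apply: kmon_mul_l; rewrite def_n def_m.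
- by rewrite (subvP (X_kap_ideal m)) ?XIr.
pose phi t := mon k m (Node o s t).
suffices /subvP/(_ h hK) : (kap_space n <= linfun (ext phi (n := n)) @^-1: kap_ideal m)%VS.
  by rewrite -memv_preim lfunE.
apply: kap_spaceP => a b c def_n; rewrite -memv_preim lfunE /= ext_kmon // /phi.
rewrite -[X in X \in _](subrK (kmon m (Node o s a) b c)).
apply: memvD; last exact: subvP (addvSr _ _) _ (mem_kap_space _ _ _ _).
by apply: (subvP (X_kap_ideal m)); apply: kmon_mul_r; rewrite def_m -def_n !addnA.
Qed.

Let mulK_bil N o : bilinear2 (@mulQ k N kap_ideal o).
Proof. exact: mulQ_bilinear kap_tree_ideal o. Qed.
Let mulK_laws N : X_laws eps (@mulQ k N kap_ideal).
Proof. exact: X_quot_laws kap_tree_ideal X_kap_ideal. Qed.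

Lemma mulK_kap N a b c : kap (@mulQ k N kap_ideal) a b c = 0.
Proof.
have lmonE (V : lmodType k) (phi : tree -> V) o o' :
    ext phi (lmon k o o') = phi (Node o (Node o' Leaf Leaf) Leaf).
  exact: ext_monomial.
have -> : kap (@mulQ k N kap_ideal) a b c =
    ext (fun u => eval (@mulQ k N kap_ideal) u (nth 0 [:: a; b; c]) 0)
      (lmon k OpY OpX - lmon k OpY OpZ).
  by rewrite extB /kap /dl (bilBl (mulK_bil N OpY)); congr (_ - _); rewrite lmonE.
apply: (ext3_eq0 kap_tree_ideal) => s0 s1 s2.
rewrite extB [X in X - _]lmonE [X in _ - X]lmonE.
exact: subvP (addvSr _ _) _ (mem_kap_space _ s0 s1 s2).
Qed.

Lemma sum_dcoord (V : lmodType k) (G : bt -> nat -> V) n t : leaves t = n ->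
  \sum_(T <- dend t) G T (mark t) =
    \sum_(v : 'I_n * seq_sub (bts n)) dcoord k n t v *: G (ssval v.2) v.1.
Proof.
move=> def_n; have lt_m : (mark t < n)%N by rewrite -def_n lt_mark.
under [RHS]eq_bigr => v _ do rewrite ffunE.
have : {subset dend t <= bts n} by move=> T /nodes_dend; rewrite mem_bts def_n => ->.
elim: (dend t) => [|T s IHs] sn.
  by rewrite big_nil big1 // => v _; rewrite /= muln0 scale0r.
rewrite big_cons IHs => [|T' sT']; last by rewrite sn // inE sT' orbT.
under [RHS]eq_bigr => v _ do rewrite /= mulnDr natrD scalerDl.
rewrite big_split /=; congr (_ + _).
have sT : T \in bts n by rewrite sn ?mem_head.
rewrite (bigD1 (Ordinal lt_m, SeqSub sT)) //= !eqxx scale1r big1 ?addr0 //.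
case=> i T' ne_v; case: (eqVneq (i : nat) (mark t)) => [eq_i|]; last by rewrite mul0n scale0r.
case: eqP => [eq_T|]; last by rewrite muln0 scale0r.
by case/eqP: ne_v; congr (_, _); apply: val_inj.
Qed.

Hypothesis eps2 : eps * eps = 1.

(** In the quotient by [kap_ideal], [ev_dend] makes evaluation factor through [dcoord]. *)
Lemma dcoord_kap_ideal n (f : freeop k n) : ext (dcoord k n) f = 0 -> f \in kap_ideal n.
Proof.
move=> f0; rewrite -(ext_evQ_eq0 kap_tree_ideal _ (leqnn n)).
pose G := cval (@mulQ k n kap_ideal) (genQ n kap_ideal).
have -> : ext (evQ n kap_ideal) f =
    \sum_(v : 'I_n * seq_sub (bts n)) ext (dcoord k n) f v *: G (ssval v.2) v.1.
  transitivity (\sum_(t : ntree n) \sum_(v : 'I_n * seq_sub (bts n))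
      (f t * dcoord k n t v) *: G (ssval v.2) v.1).
    apply: eq_bigr => t _; rewrite /evQ.
    rewrite (ev_dend (mulK_bil n) (mulK_laws n) eps2 (@mulK_kap n)).
    rewrite (sum_dcoord G (eqP (valP t))) scaler_sumr.
    by apply: eq_bigr => v _; rewrite scalerA.
  rewrite exchange_big; apply: eq_bigr => v _.
  by rewrite -scaler_suml sum_ffunE; congr (_ *: _); apply: eq_bigr => t _; rewrite [RHS]ffunE.
by rewrite f0 big1 // => v _; rewrite ffunE scale0r.
Qed.

Definition dcoord_map n := linfun (ext (dcoord k n) (n := n)).

Lemma mem_lker_dcoord n f : (f \in lker (dcoord_map n)) = (ext (dcoord k n) f == 0).
Proof. by rewrite memv_ker lfunE. Qed.

Lemma leaves_ctree T i : (i < nodes T)%N -> leaves (ctree T i) = nodes T.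
Proof.
by move=> lt_i; have [D _] := ctreeP lt_i; rewrite (@nodes_dend (ctree T i)) ?D ?inE.
Qed.

(** The canonical monomials [ctree] are sent to the basis vectors. *)
Lemma dcoord_map_full n : limg (dcoord_map n) = fullv.
Proof.
apply/eqP; rewrite eqEsubv subvf; apply/subvP => w _.
pose f := \sum_v w v *: mon k n (ctree (ssval v.2) v.1).
suffices -> : w = dcoord_map n f by rewrite memv_img ?memvf.
rewrite lfunE /= ext_sum; apply/ffunP => v; rewrite sum_ffunE (bigD1 v) //=.
have lt_i (u : 'I_n * seq_sub (bts n)) : (u.1 < nodes (ssval u.2))%N.
  by have := ssvalP u.2; rewrite mem_bts => /eqP->.
have leavesT (u : 'I_n * seq_sub (bts n)) : leaves (ctree (ssval u.2) u.1) = n.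
  by rewrite leaves_ctree //; apply/eqP; rewrite -mem_bts ssvalP.
rewrite big1 => [|u ne_u]; rewrite ext_mon leavesT eqxx.
  have [D M] := ctreeP (lt_i v).
  by rewrite addr0 ffunE [dcoord _ _ _ _]ffunE D M /= !eqxx [_ *: _]mulr1.
have [D M] := ctreeP (lt_i u); rewrite ffunE [dcoord _ _ _ _]ffunE D M /=.
case: eqP => [eq_i|_]; last by rewrite mul0n scaler0.
case: eqP => [eq_T|_]; last by rewrite muln0 scaler0.
case/eqP: ne_u; case: u v eq_i eq_T {lt_i leavesT D M} => i T [j T'] /= eq_i eq_T.
by congr (_, _); apply: val_inj.
Qed.

Lemma dim_lker_dcoord n : (0 < n)%N ->
  (\dim (lker (dcoord_map n)) + 'C(2 * n, n.-1))%N = \dim {: freeop k n}.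
Proof.
move=> n_gt0; rewrite -(limg_ker_dim (dcoord_map n) fullv) capfv; congr (_ + _)%N.
rewrite dcoord_map_full dimvf /dim /= muln1 card_prod card_ord card_seq_sub ?uniq_bts //.
by rewrite size_bts.
Qed.

Lemma X_ideal_lker n : (X_ideal eps n <= lker (dcoord_map n))%VS.
Proof. by apply/subvP=> f /dcoord_X_ideal f0; rewrite mem_lker_dcoord f0. Qed.

Lemma lker_kap_ideal n : (lker (dcoord_map n) <= kap_ideal n)%VS.
Proof.
by apply/subvP=> f; rewrite mem_lker_dcoord => /eqP/dcoord_kap_ideal.
Qed.

Lemma dim_X_operad n :
  \dim {: X_operad eps n} = (\dim {: freeop k n} - \dim (X_ideal eps n))%N.
Proof. exact: dim_vquot. Qed.

End Presentation.

(** The composites of [kap] already lie in the ideal, so the squeeze is an equality. *)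
Lemma dim_X_minus (k : fieldType) n : 2%:R != 0 :> k -> (0 < n)%N -> n != 3 ->
  \dim {: X_operad (- 1 : k) n} = 'C(2 * n, n.-1).
Proof.
move=> nz2 n_gt0 ne3; have eps2 : -1 * -1 = 1 :> k by rewrite mulrNN mulr1.
rewrite dim_X_operad -(dim_lker_dcoord k n_gt0).
suffices -> : X_ideal (-1) n = lker (dcoord_map k n) by rewrite addKn.
apply/eqP; rewrite eqEsubv X_ideal_lker /=; apply: subv_trans (lker_kap_ideal eps2 n) _.
rewrite subv_add subvv /=; apply: kap_spaceP => a b c def_n.
have JI := X_ideal_tree_ideal (-1 : k).
rewrite -(ext_evQ_eq0 JI _ (leqnn n)) ext_evX_kmon // /evQ.
have mulXP o := mulQ_bilinear n JI o.
have laws := X_quot_laws n JI (fun m => subvv _).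
apply/eqP/(kap_minus mulXP laws nz2).
(* Three trees have at least three leaves, so [n != 3] leaves only [3 < n]. *)
by have [[? ?] ?] := (leaves_gt0 a, leaves_gt0 b, leaves_gt0 c); lia.
Qed.

Definition scalar_op (k : fieldType) (o : binop) (a b : k^o) : k^o :=
  match o with OpX | OpY => a * b | OpZ | OpT => 0 end.

(** * The sign +: exactly one extra dimension *)

Section Plus.

Variable k : fieldType.

(** The fifteen other laws are associativity or trivial; [lawyy] says that [- (a * b * c)] equals
    [eps] times itself, which fixes the sign +. *)
Lemma scalar_op_algebra : X_algebra (1 : k) (@scalar_op k).
Proof.
apply: X_laws_algebra.
  move=> o; split=> c a a' b; case: o => /=; rewrite ?scaler0 ?addr0 //.
  - by rewrite mulrDl -scalerAl.
  - by rewrite mulrDl -scalerAl.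
  - by rewrite mulrDr -scalerAr.
  by rewrite mulrDr -scalerAr.
split=> a b c /=; rewrite ?mulr0 ?mul0r ?addr0 ?add0r ?mulrA //.
by rewrite scale1r.
Qed.

Fixpoint xcomb (t : tree) (m : nat) : tree :=
  if m is m'.+1 then Node OpX (xcomb t m') Leaf else t.

Let top o := Node OpY (Node o Leaf Leaf) Leaf.
(** [kap] at three generators, multiplied [m] times by the generator through [x]: the one word that
    [kap_plus] leaves. At all arguments 1, [scalar_op] gives 1 on the first tree and 0 on the
    second, so it is not in the ideal. *)
Let wit m : freeop k m.+3 := mon k m.+3 (xcomb (top OpX) m) - mon k m.+3 (xcomb (top OpZ) m).

Let leaves_xcomb o m : leaves (xcomb (top o) m) = m.+3.
Proof. by elim: m => //= m ->; rewrite addn1. Qed.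

Let wit_lker m : wit m \in lker (dcoord_map k m.+3).
Proof.
rewrite mem_lker_dcoord /wit extB (ext_mon _ _ (xcomb (top OpX) m)).
rewrite (ext_mon _ _ (xcomb (top OpZ) m)) !leaves_xcomb eqxx.
have -> : dcoord k m.+3 (xcomb (top OpX) m) = dcoord k m.+3 (xcomb (top OpZ) m).
  apply/ffunP=> v; rewrite !ffunE.
  have [-> ->//] : dend (xcomb (top OpX) m) = dend (xcomb (top OpZ) m) /\
    mark (xcomb (top OpX) m) = mark (xcomb (top OpZ) m).
  by elim: m {v} => //= m [-> ->].
by rewrite subrr.
Qed.

Let wit_notin m : wit m \notin X_ideal 1 m.+3.
Proof.
apply/negP => /(eval_X_ideal scalar_op_algebra (fun=> 1)).
rewrite /wit extB (ext_mon _ _ (xcomb (top OpX) m)) (ext_mon _ _ (xcomb (top OpZ) m)).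
rewrite !leaves_xcomb eqxx.
have -> : eval (@scalar_op k) (xcomb (top OpX) m) (fun=> 1) 0 = 1.
  by elim: m => [|m IHm] /=; rewrite ?mulr1.
have -> : eval (@scalar_op k) (xcomb (top OpZ) m) (fun=> 1) 0 = 0.
  by elim: m => [|m IHm] /=; rewrite ?mul0r // IHm mul0r.
by rewrite subr0 => /eqP; rewrite oner_eq0.
Qed.

Let JI := X_ideal_tree_ideal (1 : k).

Let wit_kap m : ext (evQ m.+3 (X_ideal (1 : k))) (wit m) =
  iter m (fun a => mulQ OpX a (genQ m.+3 (X_ideal (1 : k))))
    (kap (@mulQ k m.+3 (X_ideal 1)) (genQ _ _) (genQ _ _) (genQ _ _)).
Proof.
rewrite /wit extB (ext_mon _ _ (xcomb (top OpX) m)) (ext_mon _ _ (xcomb (top OpZ) m)).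
rewrite !leaves_xcomb eqxx; move: m.+3 => N; elim: m => [|m IHm] /=.
  by rewrite /kap /dl (bilBl (mulQ_bilinear N JI OpY)).
by rewrite -IHm (bilBl (mulQ_bilinear N JI OpX)) !evX_node.
Qed.

(** The kernel of [dcoord_map] contains the ideal strictly, by [wit], and is contained in the ideal
    plus the line of [wit], by [kap_plus]. *)
Lemma dim_X_plus n : (5 <= n)%N -> \dim {: X_operad (1 : k) n} = ('C(2 * n, n.-1) + 1)%N.
Proof.
case: n => [|[|[|m]]] // lt_m; have eps2 : 1 * 1 = 1 :> k by rewrite mulr1.
rewrite dim_X_operad -(dim_lker_dcoord k (isT : 0 < m.+3)%N).
set U := X_ideal 1 m.+3; set V := lker _.
have UV : (U <= V)%VS by apply: X_ideal_lker.
have VU : (V <= U + <[wit m]>)%VS.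
  apply: subv_trans (lker_kap_ideal eps2 m.+3) _.
  rewrite subv_add addvSl /=; apply: kap_spaceP => a b c def_n.
  have mulXP o := mulQ_bilinear m.+3 JI o.
  have laws := X_quot_laws m.+3 JI (fun m => subvv _).
  have [//|k0|kI] := kap_plus mulXP laws (genQ m.+3 (X_ideal 1)) def_n.
    apply: (subvP (addvSl _ _)).
    by rewrite -(ext_evQ_eq0 JI _ (leqnn _)) ext_evX_kmon // k0.
  rewrite -[kmon _ _ _ _ _](subrK (wit m)) memvD //.
    apply: (subvP (addvSl _ _)).
    by rewrite -(ext_evQ_eq0 JI _ (leqnn _)) extB ext_evX_kmon // wit_kap kI subrr.
  by apply: (subvP (addvSr _ _)); apply: memv_line.
have lt_dim : (\dim U < \dim V)%N.
  rewrite ltn_neqAle dimvS // andbT; apply: contra (wit_notin m) => eq_dim.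
  have -> : X_ideal 1 m.+3 = V by apply/eqP; rewrite eqEdim UV -(eqP eq_dim) leqnn.
  exact: wit_lker.
have le_dim : (\dim V <= \dim U + 1)%N.
  apply: leq_trans (dimvS VU) _.
  by apply: leq_trans (dimv_add_leqif _ _) _; rewrite leq_add2l dim_vline leq_b1.
by lia.
Qed.

End Plus.

Local Close Scope ring_scope.
Unset Implicit Arguments.

Theorem theorem6p1 (p : nat) (hp : prime p) :
  (p <> 2 ->
     (forall n : nat, 1 <= n -> n <> 3 ->
        \dim {: Xminus 'F_p n} = 'C(2 * n, n.-1)) /\
     (forall n : nat, 5 <= n ->
        \dim {: Xplus 'F_p n} = 'C(2 * n, n.-1) + 1)) /\
  (p = 2 ->
     forall n : nat, 5 <= n ->
       \dim {: Xminus 'F_p n} = 'C(2 * n, n.-1) + 1 /\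
       \dim {: Xplus 'F_p n} = 'C(2 * n, n.-1) + 1).
Proof.
have plus n : 5 <= n -> \dim {: Xplus 'F_p n} = 'C(2 * n, n.-1) + 1.
  exact: dim_X_plus.
split=> [p_neq2|p2 n n_ge5].
  split=> [n n_gt0 n_neq3|]; last exact: plus.
  apply: dim_X_minus => //; last exact/eqP.
  by rewrite -(dvdn_pcharf (pchar_Fp hp)) dvdn_prime2 //; apply/eqP.
split; last exact: plus.
(* In characteristic 2 the sign -1 is 1; the sign is made a variable so that it can be replaced. *)
suffices minus1 (eps : 'F_p) : eps = 1%R ->
    \dim {: X_operad eps n} = 'C(2 * n, n.-1) + 1.
  by apply: minus1; rewrite p2; apply: val_inj.
by move=> ->; apply: dim_X_plus.
Qed.
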